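(* Consider the nonlinearly periodically forced delay equation $\dot x(t)=F(t,x_t)$ with equilibrium $\overline{x}$ as in the context, with $k\ge 2$. Suppose that $0$ is a simple eigenvalue of $A$ and that it is the only eigenvalue of $A$ on the imaginary axis. Let $q\in\mathbb{R}^n$ (column) and $p\in\mathbb{R}^{n\star}$ (row) satisfy $$\Delta(0)q=0,\qquad p\Delta(0)=0,\qquad p\Delta'(0)q=1,$$ and let $\varphi\in X$ be the constant function $\varphi(\theta)=q$. Parametrize the $2$-dimensional local center manifold of $\overline{x}$ near $\overline{x}$ so that solutions on it are $x_t=\mathcal{H}(t,\xi(t))$ with $$\mathcal{H}(t,\xi)=\overline{x}+\xi\varphi+\tfrac12H_2(t)\xi^2+\mathcal{O}(\xi^3),\qquad \xi\in\mathbb{R},$$ where $H_2$ is $T$-periodic, and such that $\xi$ satisfies the periodically forced critical normal form $\dot\xi=b\xi^2+\mathcal{O}(|\xi|^3)$ with $b\in\mathbb{R}$ and $T$-periodic $\mathcal{O}$-terms. Then the critical normal form coefficient is $$b=\frac{1}{2T}\int_0^T p\,B(t;\varphi,\varphi)\,dt .$$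
   Context: Let $0<h<\infty$, $X=C([-h,0],\mathbb{R}^n)$ with the supremum norm, $x_t(\theta)=x(t+\theta)$, and let $F:\mathbb{R}\times X\to\mathbb{R}^n$ be $C^k$-smooth. Assume $\overline{x}$ is an equilibrium (constant solution) of $\dot x(t)=F(t,x_t)$, that $L:=D_2F(t,\overline{x})$ is independent of $t$, and that $G(t,\varphi)=F(t,\overline{x}+\varphi)-F(t,\overline{x})-L\varphi$ is $T$-periodic in $t$ ($T>0$). Write $L\varphi=\int_0^hd\zeta(\theta)\varphi(-\theta)$ with $\zeta:[0,h]\to\mathbb{R}^{n\times n}$ of normalized bounded variation. $A$ is the generator $\mathcal{D}(A)=\{\varphi\in X:\varphi'\in X,\ \varphi'(0)=L\varphi\}$, $A\varphi=\varphi'$; its spectrum consists of the zeros of $\det\Delta(z)$, where $\Delta(z)=zI-\int_0^he^{-z\theta}d\zeta(\theta)$, and $\Delta'$ is the derivative in $z$. $B(t;\varphi_1,\varphi_2):=D_2^2F(t,\overline{x})(\varphi_1,\varphi_2)$ is the second Fréchet derivative in the second argument. The local center manifold of $\overline{x}$ is the $T$-periodic, $C^k$-smooth, locally positively invariant manifold in $\mathbb{R}\times X$ containing $\mathbb{R}\times\{\overline{x}\}$ and tangent there to $\mathbb{R}\times X_0$, where $X_0=\mathrm{span}\{\varphi\}$ is the generalized eigenspace of $A$ for the imaginary-axis spectrum $\{0\}$; a parametrization and normal form as in the claim exist for it. The coefficients are determined by inserting $\mathcal{H}$ and the normal form into the equation (homological equation) and comparing equal powers of $\xi$. *)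

(* Defs.v *)
From HB Require Import structures.
From mathcomp Require Import all_boot all_order all_algebra.
From mathcomp Require Import complex.
From mathcomp Require Import all_classical all_reals all_analysis.

Set Implicit Arguments.
Unset Strict Implicit.
Unset Printing Implicit Defensive.

Import Order.TTheory GRing.Theory Num.Theory.
Import numFieldNormedType.Exports.

Local Open Scope classical_set_scope.
Local Open Scope ring_scope.

Section SupNorm.
Context {R : realType} {I : Type}.

Definition supn (A : set I) (f : I -> R) : R := sup (f @` A).

Lemma supn_ub (A : set I) (f : I -> R) (i : I) :
  has_ubound (f @` A) -> A i -> f i <= supn A f.
Proof. by move=> ub Ai; apply: ub_le_sup => //; exists i. Qed.

Lemma supn_le (A : set I) (f : I -> R) (c : R) :
  0 <= c -> (forall i, A i -> f i <= c) -> supn A f <= c.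
Proof.
move=> c0 fc; have [->|/set0P A0] := eqVneq A set0.
  by rewrite /supn image_set0 sup0.
apply: ge_sup; first by case: A0 => i Ai; exists (f i); exists i.
by move=> _ [i Ai <-]; exact: fc.
Qed.

Lemma supn_ge0 (A : set I) (f : I -> R) :
  has_ubound (f @` A) -> (forall i, 0 <= f i) -> 0 <= supn A f.
Proof.
move=> ub f0; have [->|/set0P[i Ai]] := eqVneq A set0.
  by rewrite /supn image_set0 sup0.
exact: le_trans (f0 i) (supn_ub ub Ai).
Qed.

Lemma supnZ (A : set I) (f : I -> R) (c : R) :
  0 <= c -> has_ubound (f @` A) -> (forall i, 0 <= f i) ->
  supn A (fun i => c * f i) = c * supn A f.
Proof.
move=> c0 ub f0; apply/eqP; rewrite eq_le; apply/andP; split.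
  apply: supn_le; first by rewrite mulr_ge0 ?supn_ge0.
  by move=> i Ai; rewrite ler_wpM2l// supn_ub.
have [->|cn0] := eqVneq c 0.
  rewrite mul0r; apply: supn_ge0; last by move=> i; rewrite mul0r.
  by exists 0 => _ [i _ <-]; rewrite mul0r.
have cgt0 : 0 < c by rewrite lt_neqAle eq_sym cn0.
have [M MP] := ub.
have ub' : has_ubound ((fun i => c * f i) @` A).
  by exists (c * M) => _ [i Ai <-]; rewrite ler_wpM2l//; apply: MP; exists i.
rewrite -ler_pdivlMl//; apply: supn_le.
  by rewrite mulr_ge0 ?invr_ge0// supn_ge0// => i; rewrite mulr_ge0.
by move=> i Ai; rewrite ler_pdivlMl//; exact: (supn_ub ub').
Qed.

End SupNorm.

Lemma continuous_lincomb {R : realType} {T : topologicalType}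
    {V : normedModType R} (a : R) (f g : T -> V) :
  continuous f -> continuous g -> continuous (a *: f + g).
Proof. by move=> cf cg x; apply: cvgD; [apply: cvgZr; exact: cf|exact: cg]. Qed.

Section BoundedLinear.
Context {R : realType} (E V : normedModType R).

Definition blin_pred : {pred E -> V} :=
  fun f => `[< linear f /\ continuous f >].

Record blin := BLin { blin_fun :> E -> V ; _ : blin_fun \in blin_pred }.

HB.instance Definition _ := [isSub for blin_fun].
HB.instance Definition _ := [Choice of blin by <:].

Lemma blin_submod : submod_closed blin_pred.
Proof.
split=> [|a f g /asboolP[lf cf] /asboolP[lg cg]]; apply/asboolP; split.
- by move=> a x y; change (0 = a *: 0 + 0 :> V); rewrite scaler0 addr0.
- by move=> x; exact: cvg_cst.
- move=> c x y; change (a *: f (c *: x + y) + g (c *: x + y) =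
    c *: (a *: f x + g x) + (a *: f y + g y)).
  by rewrite lf lg !scalerDr !scalerA mulrC addrACA.
- exact: continuous_lincomb.
Qed.

HB.instance Definition _ := GRing.isSubmodClosed.Build R (E -> V) blin_pred
  blin_submod.
HB.instance Definition _ := [SubChoice_isSubLmodule of blin by <:].

Lemma blin_linear (f : blin) : linear f.
Proof. by case: f => f /= /asboolP[]. Qed.

Lemma blin_continuous (f : blin) : continuous f.
Proof. by case: f => f /= /asboolP[]. Qed.

Definition blin_norm (f : blin) : R := supn [set x | `|x| <= 1] (fun x => `|f x|).

Lemma blin_bounded (f : blin) :
  has_ubound ((fun x => `|f x|) @` [set x : E | `|x| <= 1]).
Proof.
pose g : {linear E -> V} :=
  HB.pack (f : E -> V) (GRing.isLinear.Build R E V *:%R f (@blin_linear f)).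
have gc : continuous g by exact: blin_continuous.
have /bounded_funP/(_ 1)[M gM] := (linear_bounded_continuous g).2 gc.
by exists M => _ [x x1 <-]; exact: gM.
Qed.

Lemma ler_blin_normD (f g : blin) :
  blin_norm (f + g) <= blin_norm f + blin_norm g.
Proof.
apply: supn_le; first by rewrite addr_ge0 ?supn_ge0//; exact: blin_bounded.
move=> x x1; rewrite (le_trans (ler_normD _ _))// lerD//;
  by rewrite (supn_ub (blin_bounded _)).
Qed.

Lemma blin_normZ (l : R) (f : blin) : blin_norm (l *: f) = `|l| * blin_norm f.
Proof.
rewrite /blin_norm -supnZ//; last exact: blin_bounded.
by congr supn; apply/funext => x; rewrite -normrZ.
Qed.

Lemma blin_norm_eq0 (f : blin) : blin_norm f = 0 -> f = 0.
Proof.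
move=> f0; apply/val_inj/funext => x.
have f00 : f 0 = 0.
  by have := blin_linear f (-1) 0 0; rewrite scaler0 addr0 scaleN1r addNr.
change (f x = 0).
have [->//|xn0] := eqVneq x 0.
have nx : `|x| != 0 by rewrite normr_eq0.
have := supn_ub (i := `|x|^-1 *: x) (blin_bounded f).
rewrite -/(blin_norm f) f0 /= normrZ normfV normr_id mulVf// => /(_ (lexx _)).
rewrite normr_le0 => /eqP fx0.
have := blin_linear f `|x| (`|x|^-1 *: x) 0.
by rewrite fx0 f00 scalerA mulfV// scale1r !addr0 scaler0.
Qed.

HB.instance Definition _ := Lmodule_isNormed.Build R blin
  ler_blin_normD blin_normZ blin_norm_eq0.

End BoundedLinear.

Section Smoothness.
Context {R : realType}.

(* 'd f x as a point of the normed space of bounded linear maps; the default 0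
   plays no role where f is differentiable. *)
Definition fderiv (E V : normedModType R) (f : E -> V) (x : E) : blin E V :=
  insubd (0 : blin E V) ('d f x : E -> V).

(* Only meant for U open. *)
Fixpoint Ck_on (E : normedModType R) (U : set E) (k : nat) :
    forall V : normedModType R, (E -> V) -> Prop :=
  match k with
  | 0%N => fun V f => {in U, continuous f}
  | k'.+1 => fun V f => (forall x, U x -> differentiable f x) /\
                        @Ck_on E U k' (blin E V) (fderiv f)
  end.

End Smoothness.

Section HistorySpace.
Context {R : realType} (h : R) (n : nat).

Local Notation delays := (set_type `[- h, 0]%classic).

Definition hist_pred : {pred delays -> 'cV[R]_n} := fun f => `[< continuous f >].

Record hist := Hist { hist_fun :> delays -> 'cV[R]_n ; _ : hist_fun \in hist_pred }.

HB.instance Definition _ := [isSub for hist_fun].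
HB.instance Definition _ := [Choice of hist by <:].

Lemma hist_submod : submod_closed hist_pred.
Proof.
split=> [|a f g /asboolP cf /asboolP cg]; apply/asboolP.
  by move=> x; exact: cst_continuous.
exact: continuous_lincomb.
Qed.

HB.instance Definition _ :=
  GRing.isSubmodClosed.Build R (delays -> 'cV[R]_n) hist_pred hist_submod.
HB.instance Definition _ := [SubChoice_isSubLmodule of hist by <:].

Lemma hist_continuous (f : hist) : continuous f.
Proof. by case: f => f /= /asboolP. Qed.

Definition hist_norm (f : hist) : R := supn setT (fun x => `|f x|).

Lemma hist_bounded (f : hist) : has_ubound ((fun x => `|f x|) @` setT).
Proof.
have cf : {within `[- h, 0]%classic, continuous (valL_ 0 f)}.
  by apply/subspace_valL_continuousP'; exact: hist_continuous.
have /compact_bounded[M [_ fM]] := continuous_compact cf (@segment_compact R (- h) 0).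
exists (M + 1) => _ [x _ <-]; apply: (fM (M + 1)); first by rewrite ltrDl.
exists (\val x); first exact: set_valP.
exact: (congr1 (fun g => g x) (valLK 0 (hist_fun f))).
Qed.

Lemma ler_hist_normD (f g : hist) :
  hist_norm (f + g) <= hist_norm f + hist_norm g.
Proof.
apply: supn_le; first by rewrite addr_ge0 ?supn_ge0//; exact: hist_bounded.
move=> x x1; rewrite (le_trans (ler_normD _ _))// lerD//;
  by rewrite (supn_ub (hist_bounded _)).
Qed.

Lemma hist_normZ (l : R) (f : hist) : hist_norm (l *: f) = `|l| * hist_norm f.
Proof.
rewrite /hist_norm -supnZ//; last exact: hist_bounded.
by congr supn; apply/funext => x; rewrite -normrZ.
Qed.

Lemma hist_norm_eq0 (f : hist) : hist_norm f = 0 -> f = 0.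
Proof.
move=> f0; apply/val_inj/funext => x; apply/eqP; rewrite -normr_le0.
have : `|f x| <= hist_norm f by exact: (supn_ub (hist_bounded f)).
by rewrite f0.
Qed.

HB.instance Definition _ := Lmodule_isNormed.Build R hist
  ler_hist_normD hist_normZ hist_norm_eq0.

Lemma cst_hist_subproof (v : 'cV[R]_n) : (fun _ : delays => v) \in hist_pred.
Proof. by apply/asboolP => x; exact: cst_continuous. Qed.

Definition cst_hist (v : 'cV[R]_n) : hist := Hist (cst_hist_subproof v).

(* x_t; the default 0 is never used when x is continuous on [t - h, t]. *)
Definition segment (x : R -> 'cV[R]_n) (t : R) : hist :=
  insubd (0 : hist) (fun theta : delays => x (t + \val theta)).

End HistorySpace.

Section Stieltjes.
Context {R : realType} {K : numFieldType} {n m : nat}.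

(* Riemann-Stieltjes sum over the partition a :: s of [a, b] with tags tau. *)
Definition stieltjes_sum (a b : R) (zeta : R -> 'M[K]_n) (f : R -> 'M[K]_(n, m))
    (s : seq R) (tau : nat -> R) : 'M[K]_(n, m) :=
  \sum_(0 <= i < size s)
    (zeta (nth b (a :: s) i.+1) - zeta (nth b (a :: s) i)) *m f (tau i).

(* v = \int_a^b dzeta f, as the limit of the sums when the mesh tends to 0. *)
Definition is_stieltjes (a b : R) (zeta : R -> 'M[K]_n) (f : R -> 'M[K]_(n, m))
    (v : 'M[K]_(n, m)) : Prop :=
  forall eps : K, 0 < eps -> exists2 delta : R, 0 < delta &
    forall (s : seq R) (tau : nat -> R), itv_partition a b s ->
      (forall i, (i < size s)%N ->
        nth b (a :: s) i <= tau i <= nth b (a :: s) i.+1 /\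
        nth b (a :: s) i.+1 - nth b (a :: s) i < delta) ->
      `|stieltjes_sum a b zeta f s tau - v| < eps.

Definition stieltjes (a b : R) (zeta : R -> 'M[K]_n) (f : R -> 'M[K]_(n, m)) :
    'M[K]_(n, m) :=
  xget 0 [set v | is_stieltjes a b zeta f v].

End Stieltjes.

Section CharacteristicMatrix.
Context {R : realType} (h : R) {n : nat}.

Definition NBV (zeta : R -> 'M[R]_n) : Prop :=
  [/\ zeta 0 = 0,
      forall i j, bounded_variation 0 h (fun theta => zeta theta i j) &
      forall theta, 0 < theta < h -> zeta @ theta^'+ --> zeta theta].

Definition cexp (z : R[i]) : R[i] :=
  ((expR (complex.Re z) * cos (complex.Im z)) +i*
   (expR (complex.Re z) * sin (complex.Im z)))%C.

(* The characteristic matrix z I - \int_0^h e^(- z theta) dzeta(theta). *)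
Definition charmx (zeta : R -> 'M[R]_n) (z : R[i]) : 'M[R[i]]_n :=
  z%:M - stieltjes 0 h (fun theta => map_mx (real_complex R) (zeta theta))
           (fun theta => (cexp (- z * theta%:C%C))%:M).

End CharacteristicMatrix.

Section Generator.
Context {R : realType} {h : R} {n : nat}.
Local Notation delays := (set_type `[- h, 0]%classic).
Local Notation X := (hist h n).

(* L phi = \int_0^h dzeta(theta) phi(- theta); valL_ 0 phi extends phi by 0
   outside [- h, 0], where it is not evaluated. *)
Definition represents (zeta : R -> 'M[R]_n) (L : X -> 'cV[R]_n) : Prop :=
  forall phi : X,
    is_stieltjes 0 h zeta (fun theta => valL_ 0 phi (- theta)) (L phi).

(* The graph of A: phi \in D(A) and A phi = psi. At the end points of [- h, 0]
   the derivative is one-sided. *)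
Definition generator (L : X -> 'cV[R]_n) (phi psi : X) : Prop :=
  (forall theta : delays,
    (fun s : delays => (\val s - \val theta)^-1 *: (phi s - phi theta))
      @ theta^' --> psi theta) /\
  (forall theta : delays, \val theta = 0 -> psi theta = L phi).

(* Complexification: (u.1, u.2) stands for u.1 + i u.2. *)
Definition cgenerator (L : X -> 'cV[R]_n) (u v : X * X) : Prop :=
  generator L u.1 v.1 /\ generator L u.2 v.2.

Definition cscale (z : R[i]) (u : X * X) : X * X :=
  (complex.Re z *: u.1 - complex.Im z *: u.2,
   complex.Re z *: u.2 + complex.Im z *: u.1).

Definition eigenvalue_of (L : X -> 'cV[R]_n) (z : R[i]) : Prop :=
  exists2 u : X * X, u != 0 & cgenerator L u (cscale z u).

(* u \in ker (A - z)^m *)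
Fixpoint gen_ker (L : X -> 'cV[R]_n) (z : R[i]) (m : nat) (u : X * X) : Prop :=
  match m with
  | 0%N => u = 0
  | m'.+1 => exists2 v, cgenerator L u v & gen_ker L z m' (v - cscale z u)
  end.

Definition gen_eigenspace (L : X -> 'cV[R]_n) (z : R[i]) : set (X * X) :=
  [set u | exists m, gen_ker L z m u].

(* Algebraic simplicity: the generalized eigenspace is a complex line. *)
Definition simple_eigenvalue (L : X -> 'cV[R]_n) (z : R[i]) : Prop :=
  exists2 u : X * X, u != 0 &
    gen_eigenspace L z = [set cscale c u | c in [set: R[i]]].

Definition X0 (L : X -> 'cV[R]_n) : set X :=
  [set psi | gen_eigenspace L 0 (psi, 0)].

End Generator.

Section DelayEquation.
Context {R : realType} {h : R} {n : nat}.
Local Notation X := (hist h n).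
Implicit Types (F : R * X -> 'cV[R]_n) (xbar : 'cV[R]_n).

(* x solves x'(t) = F(t, x_t) on [s, t1], with initial history x_s. *)
Definition solution F (s t1 : R) (x : R -> 'cV[R]_n) : Prop :=
  {within `[s - h, t1], continuous x} /\
  forall t, s < t < t1 -> is_derive t 1 x (F (t, segment h x t)).

Definition equilibrium F xbar : Prop :=
  forall s t1, s < t1 -> solution F s t1 (fun=> xbar).

Definition D2F F (t : R) (psi : X) : blin X 'cV[R]_n :=
  fderiv (fun y : X => F (t, y)) psi.

Definition D2F2 F (t : R) (psi : X) : blin X (blin X 'cV[R]_n) :=
  fderiv (D2F F t) psi.

(* G(t, phi) *)
Definition nonlinear F xbar (L : X -> 'cV[R]_n) (t : R) (phi : X) : 'cV[R]_n :=
  F (t, cst_hist h xbar + phi) - F (t, cst_hist h xbar) - L phi.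

End DelayEquation.

Section Surface.
Context {R : realType} {E : normedModType R}.

(* g is a C^k parametrization of a relatively open part of M around p. *)
Definition Ck_chart (k : nat) (M : set E) (p : E) (U : set (R * R))
    (g : R * R -> E) : Prop :=
  [/\ open U /\ U 0, g 0 = p, Ck_on U k g &
      [/\ forall u, U u -> injective ('d g u), {in U &, injective g} &
      forall V, open V -> V `<=` U ->
        exists N, open N /\ g @` V = M `&` N]].

(* M is an embedded 2-dimensional C^k submanifold of E. *)
Definition Ck_surface (k : nat) (M : set E) : Prop :=
  forall p, M p -> exists U g, Ck_chart k M p U g.

Definition tangent_space (k : nat) (M : set E) (p : E) (S : set E) : Prop :=
  exists U g, Ck_chart k M p U g /\ range ('d g 0) = S.

End Surface.

Section CenterManifold.
Context {R : realType} {h : R} {n : nat}.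
Local Notation X := (hist h n).
Implicit Types (F : R * X -> 'cV[R]_n) (xbar : 'cV[R]_n) (W : set (R * X)).

Definition locally_positively_invariant F xbar W : Prop :=
  exists2 eps : R, 0 < eps &
    forall s t1 x, s < t1 -> solution F s t1 x -> W (s, segment h x s) ->
      (forall t, s <= t <= t1 -> `|segment h x t - cst_hist h xbar| < eps) ->
      W (t1, segment h x t1).

Record local_center_manifold (k : nat) (T : R) F xbar (L : X -> 'cV[R]_n) W :
    Prop := {
  lcm_periodic : forall t psi, W (t + T, psi) <-> W (t, psi) ;
  lcm_smooth : Ck_surface k W ;
  lcm_invariant : locally_positively_invariant F xbar W ;
  lcm_contains : forall t, W (t, cst_hist h xbar) ;
  lcm_tangent : forall t,
    tangent_space k W (t, cst_hist h xbar) ([set: R] `*` X0 L)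
}.

(* Near R x {xbar}, W is {(t, H(t, xi)) : |xi| < delta}. *)
Record parametrizes xbar W (delta : R) (H : R -> R -> X) : Prop := {
  par_cts : {in [set u : R * R | `|u.2| < delta],
              continuous (fun u : R * R => H u.1 u.2)} ;
  par_inj : forall t xi1 xi2, `|xi1| < delta -> `|xi2| < delta ->
    H t xi1 = H t xi2 -> xi1 = xi2 ;
  par_in : forall t xi, `|xi| < delta -> W (t, H t xi) ;
  par_onto : exists2 eps : R, 0 < eps &
    forall t psi, W (t, psi) -> `|psi - cst_hist h xbar| < eps ->
      exists2 xi, `|xi| < delta & psi = H t xi
}.

(* H(t, xi) = xbar + xi phi + (1/2) H2(t) xi^2 + O(xi^3), uniformly in t. *)
Definition expansion xbar (phi : X) (H2 : R -> X) (H : R -> R -> X) : Prop :=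
  exists C : R, \forall xi \near (0 : R), forall t,
    `|H t xi - (cst_hist h xbar + xi *: phi + (2^-1 * xi ^+ 2) *: H2 t)|
      <= C * `|xi| ^+ 3.

(* Solutions x_t = H(t, xi(t)) on the manifold have coordinate xi satisfying
   xi' = b xi^2 + rho(t, xi), with rho(t, xi) = O(|xi|^3) uniformly in t. *)
Definition normal_form F (T delta : R) (H : R -> R -> X) (b : R) : Prop :=
  exists rho : R -> R -> R,
  [/\ forall t xi, rho (t + T) xi = rho t xi,
      exists C : R, \forall xi \near (0 : R), forall t,
        `|rho t xi| <= C * `|xi| ^+ 3 &
      forall s t1 x xi, s < t1 -> solution F s t1 x ->
        (forall t, s <= t <= t1 ->
          `|xi t| < delta /\ segment h x t = H t (xi t)) ->
        {within `[s, t1], continuous xi} /\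
        forall t, s < t < t1 ->
          is_derive t 1 xi (b * xi t ^+ 2 + rho t (xi t))].

End CenterManifold.

(* Main.v *)
Require Import Defs.
From HB Require Import structures.
From mathcomp Require Import all_boot all_order all_algebra.
From mathcomp Require Import complex.
From mathcomp Require Import all_classical all_reals all_analysis.
From mathcomp Require Import ring lra.

Set Implicit Arguments.
Unset Strict Implicit.
Unset Printing Implicit Defensive.

Import Order.TTheory GRing.Theory Num.Theory.
Import numFieldNormedType.Exports.

Local Open Scope classical_set_scope.
Local Open Scope ring_scope.

(** The homological equation is obtained without differentiating H: it is read
    off from genuine orbits of the delay equation that start on the manifold.

    Fix a time s and a small e > 0, and solve the equation from the history
    H(s, e) (lemma [local_solution]: Picard iteration, over a time that does not
    depend on e).  Local invariance keeps the solution on the manifold, so that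
    x_t = H(t, xi(t)), and the normal form gives
    xi(t) = e + b (t - s) e^2 + O(e^3) ([center_orbit]).  Hence
      x_t = xbar + e phi + e^2 (b (t - s) phi + H2(t) / 2) + O(e^3)
    ([orbit_expansion]).  Two facts follow by letting e tend to 0.

    - Since x_t(theta) depends on t + theta only, so does the coefficient of
      e^2; with u(t) = H2(t)(0) this is
        H2(t)(theta) = 2 b theta q + u(t + theta)     ([H2_transport]).
    - Since x'(t) = F(t, x_t) and L phi = 0, the second-order Taylor expansion
      of F at xbar gives
        b q + u'(t) / 2 = (L H2(t) + B(t; phi, phi)) / 2     ([H2_velocity]).

    Let U be a primitive of u.  By the first fact,
    M(t)(theta) = 2 b t theta q + U(t + theta) is a primitive of H2 in the space
    of histories, and as u is T-periodic, M(T) - M(0) is 2 b T theta q plus a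
    constant history ([ex_mean_history]).  Integrating the second fact over
    [0, T] and multiplying by p therefore gives
      int_0^T p B = 2 b T p q - 2 b T p L(theta q) - p L(constant).
    The last term is 0 because p Delta(0) = 0 ([left_null]), and
    p q - p L(theta q) = p Delta'(0) q = 1 ([normalization]), so the integral is
    2 T b.

    The last identity involves the derivative of the characteristic
    matrix under the Stieltjes integral.  All the integrals that occur are
    values of L at explicit histories, so that the boundedness of L replaces
    estimates by the variation of zeta ([Lmx_comb_norm], [charmx_taylor]). *)

(** * Norm estimates for curves and their derivatives *)

Section MatrixNorm.
Context {K : numFieldType} {m n : nat}.
Implicit Type M : 'M[K]_(m, n).

Lemma mx_norm_le M (c : K) :
  0 <= c -> (forall i j, `|M i j| <= c) -> `|M| <= c.
Proof.
move=> c0 Mc; rewrite [leLHS]/Num.Def.normr/= mx_normE.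
rewrite -[c]/((NngNum c0)%:num) num_le; apply/bigmax_leP; split; first by rewrite -num_le.
by move=> [i j] _; rewrite -num_le/=.
Qed.

Lemma mx_norm_entry M i j : `|M i j| <= `|M|.
Proof.
rewrite [leRHS]/Num.Def.normr/= mx_normE.
apply: (@le_trans _ _ (`|M i j|%:nng%:num)) => //; rewrite num_le.
exact: (le_bigmax _ (fun ij => `|M ij.1 ij.2|%:nng) (i, j)).
Qed.

End MatrixNorm.

Lemma col_norm_le (R : realType) (n : nat) (v : 'cV[R]_n) (c : R) :
  0 <= c -> (forall i, `|v i 0| <= c) -> `|v| <= c.
Proof. by move=> c0 vc; apply: mx_norm_le => // i j; rewrite ord1. Qed.

Lemma is_derive_colP (R : realType) (n : nat) (x : R -> 'cV[R]_n) (t : R)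
    (v : 'cV[R]_n) :
  is_derive t 1 x v <-> forall i, is_derive t 1 (fun s => x s i 0) (v i 0).
Proof.
split=> [xv i|xv].
  have dx : derivable x t 1 by [].
  have dxi : derivable (fun s => x s i 0) t 1 by have/derivable_mxP := dx.
  apply: DeriveDef => //.
  have <- : 'D_1 x t = v by apply: derive_val.
  by rewrite (derive_mx dx) mxE.
have dx : derivable x t 1.
  by apply/derivable_mxP => i j; rewrite ord1; case: (xv i).
apply: DeriveDef => //.
rewrite (derive_mx dx); apply/matrixP => i j; rewrite !mxE ord1.
by apply: derive_val.
Qed.

(** Subtracting the slope m from the derivative makes the same statement serve
    as a Lipschitz bound (m = 0) and as a first-order expansion. *)
Lemma mean_value_bound (R : realType) (f df : R -> R) (a b m c : R) :
  a <= b -> (forall t, a < t < b -> is_derive t 1 f (df t)) ->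
  {within `[a, b], continuous f} ->
  (forall t, a < t < b -> `|df t - m| <= c) ->
  `|f b - f a - m * (b - a)| <= c * (b - a).
Proof.
rewrite le_eqVlt => /predU1P[->|ab] fdf cf dfc.
  by rewrite !subrr !mulr0 subrr normr0.
have fdf' x : x \in `]a, b[%R -> is_derive x 1 f (df x) by rewrite in_itv => /fdf.
have [x] := MVT ab fdf' cf.
rewrite in_itv => /dfc dfx ->.
by rewrite -mulrBl normrM (gtr0_norm (x := b - a)) ?subr_gt0// ler_wpM2r// subr_ge0 ltW.
Qed.

Lemma mean_value_col (R : realType) (n : nat) (f df : R -> 'cV[R]_n) (a b c : R) :
  0 <= c -> a <= b -> (forall t, a < t < b -> is_derive t 1 f (df t)) ->
  {within `[a, b], continuous f} ->
  (forall t, a < t < b -> `|df t| <= c) ->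
  `|f b - f a| <= c * (b - a).
Proof.
move=> c0 ab fdf cf dfc; apply: col_norm_le => [|i].
  by rewrite mulr_ge0// subr_ge0.
have := @mean_value_bound _ (fun t => f t i 0) (fun t => df t i 0) a b 0 c ab.
rewrite mul0r subr0 !mxE; apply.
- by move=> t tab; exact: (is_derive_colP f t (df t)).1 (fdf t tab) i.
- move=> t; apply: (@continuous_comp (subspace `[a, b]) _ _ f (fun v : 'cV[R]_n => v i 0)); first exact: cf.
  exact: coord_continuous.
- by move=> t tab; rewrite subr0 (le_trans (mx_norm_entry _ _ _))// dfc.
Qed.

(** Two mean value estimates: the first puts f1 t within c of
    f1 0 + t f2 0, the second compares f with its Taylor polynomial. *)
Lemma taylor2_bound (R : realType) (f f1 f2 : R -> R) (c : R) :
  (forall t : R, is_derive t 1 f (f1 t)) ->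
  (forall t : R, is_derive t 1 f1 (f2 t)) ->
  (forall t : R, 0 <= t <= 1 -> `|f2 t - f2 0| <= c) ->
  `|f 1 - f 0 - f1 0 - 2^-1 * f2 0| <= c.
Proof.
move=> ff1 f12 f2c.
have c0 : 0 <= c.
  by apply: le_trans (f2c 0 _) => //; rewrite lexx ler01.
have cts (g g1 : R -> R) A : (forall t : R, is_derive t 1 g (g1 t)) ->
    {within A, continuous g}.
  move=> gg1; apply: continuous_subspaceT => t.
  by apply: differentiable_continuous; apply/derivable1_diffP.
have f1c (t : R) : 0 <= t <= 1 -> `|f1 t - f1 0 - f2 0 * t| <= c.
  move=> /andP[t0 t1].
  have := @mean_value_bound _ f1 f2 0 t (f2 0) c t0 (fun s _ => f12 s) (cts _ _ _ f12).
  rewrite subr0 => H; apply: le_trans (H _) _.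
    by move=> s /andP[s0 st]; apply: f2c; rewrite ltW//= (le_trans (ltW st)).
  by rewrite ler_piMr.
pose g t := f t - 2^-1 * f2 0 * t ^+ 2.
have gd (t : R) : is_derive t 1 g (f1 t - f2 0 * t).
  pose H := is_deriveB (ff1 t) (is_deriveZ (2^-1 * f2 0)
    (is_deriveX 2 (is_derive_id t (1 : R)))).
  apply: (is_derive_eq (df := _) H).
  by rewrite /GRing.scale/=; field.
have := @mean_value_bound _ g (fun t => f1 t - f2 0 * t) 0 1 (f1 0) c ler01
  (fun s _ => gd s) (cts _ _ _ gd).
rewrite /g subr0 !mulr1 expr1n mulr1 expr0n mulr0 subr0.
move=> H; have -> : f 1 - f 0 - f1 0 - 2^-1 * f2 0 =
  f 1 - 2^-1 * f2 0 - f 0 - f1 0 by ring.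
apply: H => t /andP[/ltW t0 /ltW t1].
by rewrite addrAC; apply: f1c; rewrite t0.
Qed.

Lemma is_derive_continuous (R : realType) (V : normedModType R) (f : R -> V) (t : R) (v : V) :
  is_derive t 1 f v -> {for t, continuous f}.
Proof.
by move=> ft; apply: differentiable_continuous; apply/derivable1_diffP; case: ft.
Qed.

Lemma ex_primitive_right (R : realType) (g : R -> R) (a : R) :
  continuous g -> exists G : R -> R, forall t : R, a < t -> is_derive t 1 G (g t).
Proof.
move=> cg; exists (fun x => \int[lebesgue_measure]_(t in `[a, x]) g t)%R => t at_.
have tt1 : t < t + 1 by rewrite ltrDl.
have ig : lebesgue_measure.-integrable `[a, t + 1] (EFin \o g).
  apply: continuous_compact_integrable; first exact: segment_compact.
  exact: continuous_subspaceT.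
have [dG G'] := continuous_FTC1_closed tt1 ig at_ (cg t).
by apply: DeriveDef => //; rewrite -derive1E.
Qed.

Lemma is_derive_eq0_itv (R : realType) (f : R -> R) (a b : R) :
  (forall t : R, a < t < b -> is_derive t 1 f 0) ->
  forall s t : R, a < s < b -> a < t < b -> f s = f t.
Proof.
move=> f0 s t; wlog st : s t / s <= t.
  by move=> W sab tab; have [st|/ltW ts] := leP s t; [|apply/esym]; apply: W.
move=> /andP[as_ sb] /andP[at_ tb].
have H := @mean_value_bound _ f (fun=> 0) s t 0 0 st.
suff : `|f t - f s - 0 * (t - s)| <= 0 * (t - s).
  by rewrite !mul0r subr0 normr_le0 subr_eq0 => /eqP.
apply: H => [x /andP[sx xt]|x|x _]; last by rewrite subrr normr0.
  by apply: f0; rewrite (lt_trans as_)//= (lt_trans xt).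
apply: continuous_in_subspaceT x => x; rewrite inE/= in_itv/= => /andP[sx xt].
apply: is_derive_continuous; apply: f0.
by rewrite (lt_le_trans as_)//= (le_lt_trans xt).
Qed.

(** The integral over [a, x] is a primitive only for x > a, since it vanishes
    for x < a; a primitive to the right of -1 is glued at 0 to the reflection of
    another one. *)
Lemma ex_primitive (R : realType) (g : R -> R) :
  continuous g -> exists G : R -> R, forall t : R, is_derive t 1 G (g t).
Proof.
move=> cg; have [P PP] := @ex_primitive_right R _ (-1) cg.
have cgN : continuous (fun t => g (- t)).
  move=> t; apply: (@continuous_comp _ _ _ -%R g); last exact: cg.
  exact: opp_continuous.
have [Q0 Q0P] := @ex_primitive_right R _ (-1) cgN.
pose Q t := - Q0 (- t).
have QP (t : R) : t < 1 -> is_derive t 1 Q (g t).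
  move=> t1; have Nt1 : -1 < - t by rewrite ltrN2.
  have dN : is_derive t 1 (-%R : R -> R) (-1) by apply: is_deriveN.
  have := is_deriveN (is_derive1_comp (Q0P _ Nt1) dN).
  by rewrite opprK mulrN1 opprK.
have PQ (t : R) : -1 < t < 1 -> P t = Q t + (P 0 - Q 0).
  move=> t1; have -> : P 0 - Q 0 = P t - Q t; last by rewrite addrC subrK.
  apply: (@is_derive_eq0_itv _ (P - Q) (-1) 1) => //; last by lra.
  move=> s /andP[s1 s2]; rewrite -(subrr (g s)); apply: is_deriveB; first exact: PP.
  exact: QP.
exists (fun t => if 0 < t then P t else Q t + (P 0 - Q 0)) => t.
have [t0|t0] := ltP (-1) t; last first.
  have t1 : t < 0 by apply: le_lt_trans t0 _; lra.
  apply: (@near_eq_is_derive _ _ _ (fun t => Q t + (P 0 - Q 0))).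
    by near=> s; rewrite ltNge ltW//; near: s; exact: lt_nbhsl.
  rewrite -[g t]addr0; apply: is_deriveD; apply: QP; lra.
apply: (@near_eq_is_derive _ _ _ P); last exact: PP.
near=> s; case: ifPn => //; rewrite -leNgt => s0; apply: PQ.
rewrite (le_lt_trans s0 ltr01) andbT; near: s; exact: lt_nbhsr.
Unshelve. all: by end_near. Qed.

Lemma ex_primitive_col (R : realType) (n : nat) (g : R -> 'cV[R]_n) :
  continuous g ->
  exists G : R -> 'cV[R]_n, forall t : R, is_derive t 1 G (g t).
Proof.
move=> cg.
have cgi i : continuous (fun t => g t i 0).
  by move=> t; apply: (@continuous_comp _ _ _ g (fun v : 'cV[R]_n => v i 0) t (cg t));
    exact: coord_continuous.
have [G GP] := choice (fun i => ex_primitive (cgi i)).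
exists (fun t => \col_i G i t) => t; apply/is_derive_colP => i.
under eq_fun do rewrite mxE.
exact: GP.
Qed.

(** A bootstrap principle: at the first time where f reaches c, the hypothesis
    would be contradicted. *)
Lemma continuous_barrier (R : realType) (f : R -> R) (a b c : R) :
  {within `[a, b], continuous f} ->
  (forall t, a <= t <= b -> (forall s, a <= s < t -> f s < c) -> f t < c) ->
  forall t, a <= t <= b -> f t < c.
Proof.
move=> cf fP t0 t0ab; apply: contrapT => /negP; rewrite -leNgt => ct0.
pose B := [set t | a <= t <= b /\ c <= f t].
have B0 : B !=set0 by exists t0.
have lB : has_lbound B by exists a => t [/andP[]].
have iB : has_inf B by [].
set m := inf B.
have am : a <= m by apply: lb_le_inf => // t [/andP[]].
have mt0 : m <= t0 by apply: ge_inf.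
have mab : a <= m <= b by rewrite am (le_trans mt0)//; case/andP: t0ab.
have fm : f m < c.
  apply: fP => // s /andP[as_ sm]; rewrite ltNge; apply/negP => cs.
  have : m <= s.
    by apply: ge_inf => //; split=> //; rewrite as_ (le_trans (ltW sm))//; case/andP: mab.
  by rewrite leNgt sm.
have mem : `[a, b]%classic m by rewrite /= in_itv/=.
have /cvgrPdist_lt/(_ (c - f m)) := (subspace_continuousP _ _).1 cf m mem.
rewrite subr_gt0 => /(_ fm)[d /= d0 dP].
have [s [sab cs] sm] := inf_adherent d0 iB.
have ms : m <= s by apply: ge_inf.
have := dP s; rewrite /ball/= => /(_ _).
rewrite ler0_norm ?subr_le0// opprB ltrBlDl => /(_ sm).
have sab' : `[a, b]%classic s by rewrite /= in_itv/=.
move=> /(_ sab'); rewrite ltr_norml => /andP[+ _].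
by rewrite /from_subspace => fs; move: cs; rewrite leNgt => /negP; apply; lra.
Qed.

Section EpsilonDelta.
Context {R : realType}.
Implicit Types U V : normedModType R.

Lemma near_normP U (a : U) (P : U -> Prop) :
  (\forall x \near a, P x) <->
  exists2 d : R, 0 < d & forall x, `|x - a| < d -> P x.
Proof.
split=> [/nbhs_ballP[d /= d0 dP]|[d d0 dP]].
  by exists d => // x xa; apply: dP; rewrite -ball_normE /ball_/= distrC.
apply/nbhs_ballP; exists d => //= x; rewrite -ball_normE /ball_/= distrC.
exact: dP.
Qed.

Lemma continuous_normP U V (f : U -> V) (a : U) :
  {for a, continuous f} <->
  forall e : R, 0 < e ->
    exists2 d : R, 0 < d & forall x, `|x - a| < d -> `|f x - f a| <= e.
Proof.
split=> [/cvgrPdist_le fa e /fa/near_normP[d d0 dP]|fa].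
  by exists d => // x /dP; rewrite distrC.
apply/cvgrPdist_le => e /fa[d d0 dP]; apply/near_normP; exists d => // x /dP.
by rewrite distrC.
Qed.

End EpsilonDelta.

Section DerivativeEstimates.
Context {R : realType}.
Implicit Types V W : normedModType R.

(** A quotient-free form of differentiability.  Such inequalities, unlike
    difference quotients, can be established for an approximating family of
    curves and then passed to the limit. *)
Lemma is_derive_normP V (f : R -> V) (t0 : R) (d : V) :
  is_derive t0 1 f d <->
  forall e : R, 0 < e -> exists2 r : R, 0 < r & forall t, `|t - t0| < r ->
    `|f t - f t0 - (t - t0) *: d| <= e * `|t - t0|.
Proof.
have q_eq (a : R) : a != 0 ->
    `|d - a^-1 *: (f (a *: (1 : R) + t0) - f t0)| * `|a| =
    `|f (a + t0) - f t0 - a *: d|.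
  move=> a0; rewrite mulrC -normrZ scalerBr scalerA mulfV// scale1r distrC.
  by rewrite -[a *: 1]/(a * 1) mulr1.
split=> [[/cvg_ex[l fl] fd] e e0|fd].
  have ld : l = d by rewrite -fd; apply/esym/cvg_lim.
  move: fl; rewrite ld => /cvgrPdist_le/(_ e e0)[r /= r0 rP].
  exists r => // t tr; have [->|tt] := eqVneq t t0.
    by rewrite !subrr scale0r subr0 !normr0 mulr0.
  have a0 : t - t0 != 0 by rewrite subr_eq0.
  have := q_eq _ a0; rewrite subrK => <-.
  by rewrite ler_wpM2r//; apply: rP => //=; rewrite sub0r normrN.
have fl : (fun a : R => a^-1 *: (f (a *: (1 : R) + t0) - f t0)) @ 0^' --> d.
  apply/cvgrPdist_le => e /fd[r r0 rP]; exists r => // a /=.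
  rewrite sub0r normrN => ar a0.
  rewrite -(ler_pM2r (_ : 0 < `|a|)) ?normr_gt0// q_eq//.
  by have := rP (a + t0); rewrite addrK; apply.
by apply: DeriveDef; [apply/cvg_ex; exists d|exact: cvg_lim].
Qed.

Lemma is_derive_lin V W (l : V -> W) (K : R) (f : R -> V) (t0 : R) (d : V) :
  0 <= K -> (forall x y, l (x - y) = l x - l y) ->
  (forall a x, l (a *: x) = a *: l x) -> (forall x, `|l x| <= K * `|x|) ->
  is_derive t0 1 f d -> is_derive t0 1 (fun t => l (f t)) (l d).
Proof.
move=> K0 lB lZ lK /is_derive_normP fd; apply/is_derive_normP => e e0.
have K1 : 0 < K + 1 by rewrite ltr_wpDl.
have [r r0 rP] := fd _ (divr_gt0 e0 K1); exists r => // t /rP tP.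
rewrite -lZ -!lB (le_trans (lK _))//.
apply: (@le_trans _ _ ((K + 1) * (e / (K + 1) * `|t - t0|))).
  by apply: ler_pM => //; rewrite lerDl.
by rewrite mulrA [(K + 1) * _]mulrC divfK// gt_eqF.
Qed.

Lemma is_derive_scalel V (v : V) (t : R) : is_derive t 1 (fun s : R => s *: v) v.
Proof.
apply/is_derive_normP => e e0; exists 1 => // s _.
by rewrite scalerBl subrr normr0 mulr_ge0// ltW.
Qed.

Lemma is_derive_shift V (f : R -> V) (c t : R) (d : V) :
  is_derive (t + c) 1 f d -> is_derive t 1 (fun s => f (s + c)) d.
Proof.
move=> /is_derive_normP fd; apply/is_derive_normP => e /fd[r r0 rP].
exists r => // s sr; have := rP (s + c).
have -> : s + c - (t + c) = s - t by rewrite opprD addrACA subrr addr0.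
exact.
Qed.

Lemma mean_value_col_sym (n : nat) (f df : R -> 'cV[R]_n) (a b c x y : R) :
  0 <= c -> (forall t : R, a < t < b -> is_derive t 1 f (df t)) ->
  (forall t, a < t < b -> `|df t| <= c) -> a < x < b -> a < y < b ->
  `|f y - f x| <= c * `|y - x|.
Proof.
move=> c0 fdf dfc; wlog xy : x y / x <= y.
  move=> W xab yab; have [xy|/ltW yx] := leP x y; first exact: W.
  by rewrite distrC [`|y - x|]distrC; apply: W.
move=> /andP[ax xb] /andP[ay yb]; rewrite (ger0_norm (x := y - x)) ?subr_ge0//.
apply: (mean_value_col c0 xy (df := df)) => [t /andP[xt ty]||t /andP[xt ty]].
- by apply: fdf; rewrite (lt_trans ax)//= (lt_trans ty).
- apply: continuous_in_subspaceT => t; rewrite inE/= in_itv/= => /andP[xt ty].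
  by apply: is_derive_continuous; apply: fdf; rewrite (lt_le_trans ax)//= (le_lt_trans ty).
- by apply: dfc; rewrite (lt_trans ax)//= (lt_trans ty).
Qed.

(** Connectedness of [a, b]; the barrier principle is applied to the indicator
    function of the points where g differs from g a. *)
Lemma locally_constant_itv (T : Type) (g : R -> T) (a b : R) : a <= b ->
  (forall x, a <= x <= b -> exists2 d : R, 0 < d & forall y z,
    a <= y <= b -> a <= z <= b -> `|y - x| < d -> `|z - x| < d -> g y = g z) ->
  g a = g b.
Proof.
move=> ab gloc; pose f x : R := if `[< g x = g a >] then 0 else 1.
have f1 x : f x < 1 <-> g x = g a.
  by rewrite /f; case: asboolP; rewrite ?ltr01 ?ltxx.
apply/esym/f1; apply: (@continuous_barrier R f a b 1 _ _ b); last by rewrite ab lexx.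
  apply/subspace_continuousP => x; rewrite /= in_itv/= => xab.
  apply/cvgrPdist_le => e e0; have [d d0 dP] := gloc x xab.
  apply/nbhs_ballP; exists d => //= y; rewrite -ball_normE/= distrC => yx yab.
  rewrite in_itv/= in yab.
  by rewrite /from_subspace/f (dP x y) ?subrr ?normr0 ?(ltW e0)//.
move=> t tab fP; have [->|ta] := eqVneq t a; first exact/f1.
have {}ta : a < t by rewrite lt_def ta; case/andP: tab.
have [d d0 dP] := gloc t tab.
pose s := Num.max a (t - d / 2).
have sat : a <= s < t by rewrite le_max lexx/= gt_max ta/= ltrBlDr ltrDl divr_gt0.
have /andP[sa st] := sat.
apply/f1; rewrite -((f1 s).1 (fP s sat)); apply: dP => //.
- by rewrite sa (le_trans (ltW st))//; case/andP: tab.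
- by rewrite subrr normr0.
rewrite distrC ger0_norm ?subr_ge0 1?ltW// ltrBlDr -ltrBlDl.
by rewrite /s lt_max; apply/orP; right; lra.
Qed.

End DerivativeEstimates.

Lemma subrACA (V : zmodType) (a b c d : V) : a - b - (c - d) = a - c - (b - d).
Proof. by rewrite !opprB [d - c]addrC addrACA [- b + d]addrC. Qed.

Lemma zmod_telescope (V : zmodType) (y1 y2 P Q : V) :
  y1 - y2 - (y1 - P) + (y2 - Q) = P - Q.
Proof. by rewrite opprB [y1 - y2 + _]addrC subrKA subrKA. Qed.

Lemma zmod_recenter (V : zmodType) (y x p s r k m : V) :
  y - (x + p + s) + (p - r - k) + (s - m) = y - x - r - (k + m).
Proof.
rewrite !opprD !addrA (addrAC _ (- s) p) subrK.
by rewrite (addrAC _ (- k) s) (addrAC _ (- r) s) subrK.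
Qed.

Lemma zmod_cancel_drift (V : zmodType) (k1 k2 a c s r : V) :
  k1 + a - (k2 + c) - (k1 - k2 + (s - r)) = a - s - (c - r).
Proof.
have -> : k1 + a - (k2 + c) = (k1 - k2) + (a - c) by rewrite opprD addrACA.
move: (k1 - k2) => k.
by rewrite opprD [LHS]addrACA subrr add0r subrACA.
Qed.

Section NormedAlgebra.
Context {R : realType} {V : normedModType R}.
Implicit Types x y u v phi : V.

(** When y1 and y2 have expansions with the same part x of lower order, their
    distance controls the distance of the next coefficients. *)
Lemma quadratic_coef_diff x u v y1 y2 (c k : R) : 0 <= c ->
  `|y1 - (x + c *: u)| <= k -> `|y2 - (x + c *: v)| <= k ->
  c * `|u - v| <= `|y1 - y2| + 2 * k.
Proof.
move=> c0 k1 k2; rewrite -[c in c * _](ger0_norm c0) -normrZ.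
have -> : c *: (u - v) = (y1 - y2) - (y1 - (x + c *: u)) + (y2 - (x + c *: v)).
  by rewrite zmod_telescope opprD addrACA subrr add0r scalerBr.
apply: le_trans (ler_normD _ _) _; rewrite mulr_natl mulr2n addrA.
by apply: lerD k2; apply: le_trans (ler_normB _ _) _; apply: lerD.
Qed.

(** With xi = e + c e^2 + O(e^3), an expansion in powers of xi becomes one in
    powers of e whose coefficient of e^2 is c phi + u / 2. *)
Lemma quadratic_recenter x y phi u (xi e c C1 C2 M : R) :
  0 < e -> 0 <= C2 ->
  `|y - (x + xi *: phi + (2^-1 * xi ^+ 2) *: u)| <= C1 * `|xi| ^+ 3 ->
  `|xi| <= 2 * e -> `|xi - e| <= C2 * e ^+ 2 ->
  `|xi - e - c * e ^+ 2| <= C2 * e ^+ 3 -> `|u| <= M ->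
  `|y - x - e *: phi - e ^+ 2 *: (c *: phi + 2^-1 *: u)|
    <= (8 * `|C1| + C2 * `|phi| + 3 / 2 * C2 * M) * e ^+ 3.
Proof.
move=> e0 C20 yP xe x1 x2 uM.
have -> : y - x - e *: phi - e ^+ 2 *: (c *: phi + 2^-1 *: u) =
    (y - (x + xi *: phi + (2^-1 * xi ^+ 2) *: u)) + (xi - e - c * e ^+ 2) *: phi
    + (2^-1 * ((xi - e) * (xi + e))) *: u.
  have -> : 2^-1 * ((xi - e) * (xi + e)) = 2^-1 * xi ^+ 2 - e ^+ 2 * 2^-1 by ring.
  rewrite scalerDr !scalerA [c * _]mulrC !scalerBl.
  by rewrite zmod_recenter.
have e3 : 0 <= e ^+ 3 by rewrite exprn_ge0// ltW.
apply: le_trans (ler_normD _ _) _; rewrite [leRHS]mulrDl; apply: lerD.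
  apply: le_trans (ler_normD _ _) _; rewrite [leRHS]mulrDl; apply: lerD.
    apply: le_trans yP _.
    apply: (@le_trans _ _ (`|C1| * `|xi| ^+ 3)).
      by apply: ler_wpM2r; [rewrite exprn_ge0|exact: ler_norm].
    have -> : 8 * `|C1| * e ^+ 3 = `|C1| * (2 * e) ^+ 3 by ring.
    by rewrite ler_wpM2l// lerXn2r ?nnegrE// mulr_ge0// ltW.
  by rewrite normrZ mulrAC; apply: ler_wpM2r.
have h2 : 0 <= 2^-1 :> R by rewrite invr_ge0.
rewrite normrZ normrM [`|(xi - e) * _|]normrM (ger0_norm h2).
have xe3 : `|xi + e| <= 3 * e.
  by rewrite (le_trans (ler_normD _ _))// (gtr0_norm e0); lra.
have -> : 3 / 2 * C2 * M * e ^+ 3 = 2^-1 * (C2 * e ^+ 2 * (3 * e)) * M by ring.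
apply: ler_pM => //.
by apply: ler_wpM2l => //; apply: ler_pM.
Qed.

End NormedAlgebra.

Lemma le_limit0 (R : realType) (a c K e0 : R) : 0 < e0 -> 0 <= K ->
  (forall e, 0 < e < e0 -> a <= c + K * e) -> a <= c.
Proof.
move=> e00 K0 aP; apply/ler_addgt0Pr => eps eps0.
have K1 : 0 < K + 1 by rewrite ltr_wpDl.
pose e := Num.min (e0 / 2) (eps / (K + 1)).
have e_gt0 : 0 < e by rewrite lt_min !divr_gt0.
have ee0 : e < e0.
  by rewrite gt_min ltr_pdivrMr// ltr_pMr// ltr1n.
apply: le_trans (aP e _) _; first by rewrite e_gt0.
rewrite lerD2l; apply: (@le_trans _ _ ((K + 1) * e)).
  by rewrite ler_wpM2r ?lerDl// ltW.
by rewrite mulrC -ler_pdivlMr// ge_min lexx orbT.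
Qed.

(** * The space of histories *)

Section HistoryTheory.
Context {R : realType} {h : R} {n : nat}.
Local Notation delays := (set_type `[- h, 0]%classic).
Local Notation X := (hist h n).

Lemma hist_norm_ub (f : X) (th : delays) : `|f th| <= `|f|.
Proof. exact: (supn_ub (hist_bounded f)). Qed.

Lemma hist_norm_le (f : X) (c : R) :
  0 <= c -> (forall th, `|f th| <= c) -> `|f| <= c.
Proof. by move=> c0 fc; apply: supn_le => // th _; exact: fc. Qed.

Lemma delays_itv (th : delays) : - h <= \val th <= 0.
Proof. by have := set_valP th; rewrite /= in_itv. Qed.

Lemma histB (f g : X) th : (f - g) th = f th - g th. Proof. by []. Qed.
Lemma histZ (a : R) (f : X) th : (a *: f) th = a *: f th. Proof. by []. Qed.

Lemma val_delays_continuous : continuous (fun th : delays => \val th : R).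
Proof. exact: initial_continuous. Qed.

Lemma segmentE (x : R -> 'cV[R]_n) (t : R) (th : delays) :
  continuous x -> segment h x t th = x (t + \val th).
Proof.
move=> cx; rewrite /segment.
have xP : (fun theta : delays => x (t + \val theta)) \in @hist_pred R h n.
  apply/asboolP => s; apply: (@continuous_comp _ _ _ (fun s : delays => t + \val s) x).
    by apply: continuousD; [exact: cst_continuous|exact: val_delays_continuous].
  exact: cx.
by have := @insubdK _ _ X 0 _ xP => /(congr1 (fun f => f th)).
Qed.

(** Continuity of x at each point of the window becomes uniform over the window
    because [-h, 0] is compact. *)
Lemma segment_continuous (x : R -> 'cV[R]_n) :
  continuous x -> continuous (segment h x : R -> X).
Proof.
move=> cx t0; apply/cvgrPdist_le => e e0.
have : \forall t \near t0, `[- h, 0]%classic `<=` 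
    (fun th => `|x (t0 + th) - x (t + th)| <= e).
  have /compact_near_coveringP := @segment_compact R (- h) 0.
  move=> /(_ _ (nbhs t0) (fun t th => `|x (t0 + th) - x (t + th)| <= e)); apply.
  move=> th _.
  pose g (u : R * R) := x (t0 + u.1) - x (u.2 + u.1).
  have cg : {for (th, t0), continuous g}.
    apply: (@continuousB _ _ _ (fun u : R * R => x (t0 + u.1)) (fun u => x (u.2 + u.1))).
      apply: (@continuous_comp _ _ _ (fun u : R * R => t0 + u.1) x); last exact: cx.
      by apply: continuousD; [exact: cst_continuous|exact: cvg_fst].
    apply: (@continuous_comp _ _ _ (fun u : R * R => u.2 + u.1) x); last exact: cx.
    by apply: continuousD; [exact: cvg_snd|exact: cvg_fst].
  have /cvgrPdist_le/(_ e e0) := cg.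
  move=> -[[A B] /= [A1 B1] AB].
  exists (A, B) => //= -[u v] uv; have /= := AB _ uv.
  by rewrite /g/= subrr sub0r normrN.
apply: filterS => t tP; apply: hist_norm_le => [|th]; first exact: ltW.
by rewrite histB !segmentE//; apply: tP; exact: set_valP.
Qed.

End HistoryTheory.

Lemma continuous_pair (T U V : topologicalType) (f : T -> U) (g : T -> V) :
  continuous f -> continuous g -> continuous (fun t => (f t, g t)).
Proof.
move=> cf cg t.
exact: (@cvg_pair _ _ _ (nbhs t) (nbhs (f t)) (nbhs (g t)) _ _ _ f g (cf t) (cg t)).
Qed.

Section HistoryComplete.
Context {R : realType} {h : R} {n : nat}.
Local Notation delays := (set_type `[- h, 0]%classic).
Local Notation X := (hist h n).

(** A pointwise limit of a Cauchy filter is a uniform limit, hence continuous.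
    Completeness makes the contraction principle available for histories. *)
Lemma hist_complete (F : set_system X) : ProperFilter F -> cauchy F -> cvg F.
Proof.
move=> FF /cauchy_ballP Fc.
have Fcl e : 0 < e -> \forall f & g \near F, `|f - g| <= e.
  move=> e0; have := Fc e e0; apply: filterS => -[f g] /=.
  by rewrite -ball_normE => /ltW.
have Fct th : cvg ((fun f : X => f th) @ F).
  apply/cauchy_cvgP/cauchy_ballP => e e0.
  have e20 : 0 < e / 2 by rewrite divr_gt0.
  have [[A B] [FA FB] AB] := Fcl _ e20.
  exists ((fun f : X => f th) @` A, (fun f : X => f th) @` B) => /=.
    by split; [apply: filterS FA|apply: filterS FB] => f Af; exists f.
  move=> [_ _] /= [[f Af <-] [g Bg <-]]; rewrite -ball_normE /ball_/= -histB.
  rewrite (le_lt_trans (hist_norm_ub _ _))// (le_lt_trans (AB (f, g) _))//.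
  by rewrite ltr_pdivrMr// ltr_pMr// ltr1n.
pose l th := lim ((fun f : X => f th) @ F).
have Fl e : 0 < e -> \forall f \near F, forall th : delays, `|l th - (f : X) th| <= e.
  move=> e0; have [[A B] [FA FB] AB] := Fcl _ e0.
  apply: filterS FA => f Af th.
  have lf : (fun g : X => `|g th - f th|) @ F --> `|l th - f th|.
    by apply: cvg_norm; apply: cvgB; [exact: Fct|exact: cvg_cst].
  rewrite -(cvg_lim _ lf)//; apply: limr_le; first by apply/cvg_ex; exists `|l th - f th|.
  apply: filterS FB => g Bg; rewrite distrC -histB.
  by rewrite (le_trans (hist_norm_ub _ _))// (AB (f, g)).
have cl : l \in @hist_pred R h n.
  apply/asboolP => th; apply/(@cvgrPdist_le R 'cV[R]_n delays (nbhs th) (nbhs_filter th)) => e e0.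
  have e30 : 0 < e / 3 by rewrite divr_gt0.
  have /filter_ex[f fl] := Fl _ e30.
  have := @hist_continuous _ _ _ f th.
  move=> /(@cvgrPdist_le R 'cV[R]_n delays (nbhs th) (nbhs_filter th))/(_ _ e30).
  apply: filterS => s fs.
  have -> : l th - l s = (l th - f th) + (f th - f s) - (l s - f s).
    by rewrite opprB !addrA !subrK.
  have -> : e = e / 3 + e / 3 + e / 3 by field.
  by rewrite (le_trans (ler_normB _ _))// lerD// (le_trans (ler_normD _ _))// lerD.
apply/cvg_ex; exists (Hist cl); apply/cvgrPdist_le => e e0.
apply: filterS (Fl e e0) => f fl; apply: hist_norm_le; first exact: ltW.
by move=> th; exact: fl.
Qed.

HB.instance Definition _ := Uniform_isComplete.Build X hist_complete.

End HistoryComplete.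

Section Clamp.
Context {R : realType} {h : R} {n : nat} (h_ge0 : 0 <= h).
Local Notation delays := (set_type `[- h, 0]%classic).
Local Notation X := (hist h n).

Lemma clamp_subproof (t : R) : Num.max (- h) (Num.min t 0) \in `[- h, 0]%classic.
Proof.
rewrite inE /= in_itv/= le_max lexx/= ge_max oppr_le0 h_ge0/=.
by rewrite ge_min lexx orbT.
Qed.

(** Composing with the retraction of the line onto [-h, 0] extends a history
    to a continuous function with the same bound. *)
Definition clamp (t : R) : delays := exist (fun x => x \in _) _ (clamp_subproof t).

Lemma clamp_continuous : continuous clamp.
Proof.
apply: continuous_comp_initial => t.
have -> : set_val \o clamp = (fun=> - h) \max (id \min (fun=> 0)).
  by apply/funext => s; rewrite /comp set_valE.
apply: continuous_max.
  exact: cst_continuous.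
apply: continuous_min; first exact: cvg_id.
exact: cst_continuous.
Qed.

Lemma clamp_id (t : R) (th : delays) : \val th = t -> clamp t = th.
Proof.
move=> <-; apply: val_inj => /=; have /andP[h1 h2] := delays_itv th.
by rewrite (min_idPl h2) (max_idPr h1).
Qed.

Lemma clamp_le (t : R) : t <= - h -> clamp t = clamp (- h).
Proof.
move=> th; apply: val_inj => /=; rewrite !(min_idPl _) ?oppr_le0//; last first.
  by rewrite (le_trans th)// oppr_le0.
by rewrite (max_idPl th) (max_idPl (lexx _)).
Qed.

Lemma clamp_ge (t : R) : 0 <= t -> clamp t = clamp 0.
Proof. by move=> th; apply: val_inj => /=; rewrite !(min_idPr _). Qed.

Definition hext (f : X) (t : R) : 'cV[R]_n := f (clamp t).

Lemma hext_continuous (f : X) : continuous (hext f).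
Proof.
move=> t; apply: (@continuous_comp _ _ _ clamp f); first exact: clamp_continuous.
exact: hist_continuous.
Qed.

End Clamp.

(** * Second-order calculus in the history variable *)

Section BoundedLinearTheory.
Context {R : realType}.
Implicit Types E V W : normedModType R.

Lemma blinE_add E V (A B : blin E V) x : (A + B) x = A x + B x. Proof. by []. Qed.
Lemma blinE_scale E V (a : R) (A : blin E V) x : (a *: A) x = a *: A x.
Proof. by []. Qed.

Lemma blinD E V (A : blin E V) x y : A (x + y) = A x + A y.
Proof. by have := blin_linear A 1 x y; rewrite !scale1r. Qed.

Lemma blin0 E V (A : blin E V) : A 0 = 0.
Proof. by apply: (addrI (A 0)); rewrite -blinD !addr0. Qed.

Lemma blinZ E V (A : blin E V) a x : A (a *: x) = a *: A x.
Proof. by have := blin_linear A a x 0; rewrite blin0 !addr0. Qed.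

Lemma blinB E V (A : blin E V) x y : A (x - y) = A x - A y.
Proof. by rewrite -scaleN1r blinD blinZ scaleN1r. Qed.

Lemma blin_norm_ub E V (A : blin E V) x : `|A x| <= `|A| * `|x|.
Proof.
have [->|x0] := eqVneq x 0; first by rewrite blin0 !normr0 mulr0.
have nx : 0 < `|x| by rewrite normr_gt0.
have := supn_ub (i := `|x|^-1 *: x) (blin_bounded A).
rewrite /= normrZ normfV normr_id mulVf ?gt_eqF// => /(_ (lexx _)).
by rewrite blinZ normrZ normfV normr_id ler_pdivrMl// mulrC.
Qed.

Lemma blin_norm_le E V (A : blin E V) (c : R) :
  0 <= c -> (forall x, `|A x| <= c * `|x|) -> `|A| <= c.
Proof.
move=> c0 Ac; apply: supn_le => // x x1.
by rewrite (le_trans (Ac x))// ler_piMr.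
Qed.

Lemma blin_ev_continuous E V (x : E) : continuous (fun A : blin E V => A x).
Proof.
move=> A; apply/continuous_normP => e e0.
have nx : 0 < `|x| + 1 by rewrite ltr_wpDl.
exists (e / (`|x| + 1)); first by rewrite divr_gt0.
move=> B /ltW BA; rewrite -[B x - A x]/((B - A) x).
rewrite (le_trans (blin_norm_ub _ _))//.
rewrite (le_trans (ler_wpM2r _ BA))// mulrAC ler_pdivrMr// ler_pM2l//.
by rewrite lerDl.
Qed.

(** Evaluation at w is a continuous linear map on bounded linear maps. *)
Lemma is_derive_ev E E' V (f : E -> blin E' V) a v df (w : E') :
  is_derive a v f df -> is_derive a v (fun x => f x w) (df w).
Proof.
move=> [/cvg_ex[l fl]] fdf.
have lE : l = df by rewrite -fdf; apply/esym/cvg_lim.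
have fw : (fun h : R => h^-1 *: (f (h *: v + a) w - f a w)) @ 0^' --> df w.
  have := cvg_comp _ _ fl (@blin_ev_continuous E' V w l).
  by rewrite lE.
by apply: DeriveDef; [apply/cvg_ex; exists (df w)|exact: cvg_lim].
Qed.

Lemma is_derive_line E V (f : E -> V) (a v : E) (t : R) df :
  is_derive (a + t *: v) v f df -> is_derive t 1 (fun s : R => f (a + s *: v)) df.
Proof.
have e : (fun h : R => h^-1 *: (f (a + (h *: (1 : R) + t) *: v) - f (a + t *: v))) =
         (fun h : R => h^-1 *: (f (h *: v + (a + t *: v)) - f (a + t *: v))).
  apply/funext => h; congr (_ *: (f _ - _)).
  by rewrite -[h *: 1]/(h * 1) mulr1 scalerDl addrCA.
move=> [df1 df2]; apply: DeriveDef.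
  by rewrite /derivable e.
by rewrite /derive e.
Qed.

Lemma fderivE E V (f : E -> V) x v :
  differentiable f x -> fderiv f x v = 'd f x v.
Proof.
move=> fx; rewrite /fderiv; have dP : ('d f x : E -> V) \in @blin_pred R E V.
  by apply/asboolP; split; [exact: linearP|exact: diff_continuous].
by have /(congr1 (fun g => g v)) := insubdK (0 : blin E V) dP.
Qed.

Lemma is_derive_fderiv E V (f : E -> V) x v :
  differentiable f x -> is_derive x v f (fderiv f x v).
Proof.
move=> fx; apply: DeriveDef; first exact: diff_derivable.
by rewrite deriveE// fderivE.
Qed.

Lemma Ck_on_C2 E V (f : E -> V) (k : nat) : (2 <= k)%N -> Ck_on [set: E] k f ->
  [/\ forall x, differentiable f x,
      forall x, differentiable (fderiv f) x &
      continuous (fderiv (fderiv f))].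
Proof.
case: k => [//|[//|k]] _ /= [df [ddf cf]]; split.
- by move=> x; exact: df.
- by move=> x; exact: ddf.
- case: k cf => [cf x|k [dddf _] x]; first by apply: cf; rewrite inE.
  by apply: differentiable_continuous; exact: dddf.
Qed.

End BoundedLinearTheory.

(** The difference is A (c x) z + A z (c x + z). *)
Lemma bilinear_perturb (R : realType) (E V : normedModType R)
    (A : blin E (blin E V)) (x z : E) (c : R) :
  `|A (c *: x + z) (c *: x + z) - c ^+ 2 *: A x x|
    <= `|A| * `|z| * (2 * `|c| * `|x| + `|z|).
Proof.
have A2 u v : `|A u v| <= `|A| * `|u| * `|v|.
  apply: le_trans (blin_norm_ub _ _) _.
  by apply: ler_wpM2r => //; exact: blin_norm_ub.
have -> : A (c *: x + z) (c *: x + z) - c ^+ 2 *: A x x =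
    A (c *: x) z + A z (c *: x + z).
  have cc : A (c *: x) (c *: x) = c ^+ 2 *: A x x.
    by rewrite [LHS]blinZ (blinZ A c x) blinE_scale scalerA expr2.
  rewrite (blinD A (c *: x) z) blinE_add (blinD (A (c *: x)) (c *: x) z) cc.
  by rewrite -[X in X - _]addrA addrAC subrr add0r.
apply: le_trans (ler_normD _ _) _.
have -> : `|A| * `|z| * (2 * `|c| * `|x| + `|z|) =
    `|A| * (`|c| * `|x|) * `|z| + `|A| * `|z| * (`|c| * `|x| + `|z|) by ring.
apply: lerD; first by rewrite -normrZ; exact: A2.
apply: le_trans (A2 _ _) _; apply: ler_wpM2l; first by rewrite mulr_ge0.
by apply: le_trans (ler_normD _ _) _; rewrite normrZ.
Qed.

Section Restriction.
Context {R : realType} (X V : normedModType R).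

Lemma restr_subproof (A : blin (R * X)%type V) :
  (fun psi => A (0, psi)) \in @blin_pred R X V.
Proof.
apply/asboolP; split=> [a x y|x].
  rewrite -(blin_linear A); congr (A _).
  by congr pair; rewrite /= ?scaler0 ?mulr0 addr0.
apply: (@continuous_comp _ _ _ (fun psi => (0, psi)) A).
  apply: (@continuous_pair X R X (fun=> 0) id) => y; [exact: cvg_cst|exact: cvg_id].
exact: blin_continuous.
Qed.

(** A map of (t, psi) restricted to the direction of the histories. *)
Definition restr (A : blin (R * X)%type V) : blin X V := BLin (restr_subproof A).

Lemma restr_linear : linear restr.
Proof. by move=> a A B; apply/val_inj. Qed.

HB.instance Definition _ := GRing.isLinear.Build R
  (blin (R * X)%type V) (blin X V) *:%R restr restr_linear.

Lemma norm_pair0 (psi : X) : `|((0 : R), psi)| = `|psi|.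
Proof. by rewrite prod_normE/= normr0; apply: max_idPr. Qed.

Lemma restr_continuous : continuous restr.
Proof.
move=> A; apply/continuous_normP => e e0; exists e => // B /ltW BA.
rewrite -raddfB/= (le_trans _ BA)//; apply: blin_norm_le => // psi.
by rewrite -norm_pair0; exact: (blin_norm_ub (B - A)).
Qed.

End Restriction.

Section PartialDerivatives.
Context {R : realType} {h : R} {n : nat}.
Local Notation X := (hist h n).
Variable F : R * X -> 'cV[R]_n.
Hypothesis dF : forall z, differentiable F z.
Hypothesis ddF : forall z, differentiable (fderiv F) z.

Lemma differentiable_pairr (t : R) (psi : X) :
  differentiable (fun y : X => (t, y)) psi.
Proof. by apply: differentiable_pair. Qed.

Lemma is_derive_pairr (V : normedModType R) (f : R * X -> V) (t : R) (psi v : X) df :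
  is_derive (t, psi) (0, v) f df -> is_derive psi v (fun y => f (t, y)) df.
Proof.
have e : (fun a : R => a^-1 *: (f (t, a *: v + psi) - f (t, psi))) =
   (fun a : R => a^-1 *: (f (a *: (0, v) + (t, psi)) - f (t, psi))).
  apply/funext => a; congr (_ *: (f _ - _)).
  by congr pair; rewrite /= ?scaler0 ?mulr0 add0r.
move=> [df1 df2]; apply: DeriveDef.
  by rewrite /derivable e.
by rewrite /derive e.
Qed.

(** Both sides are recovered from directional derivatives, and the difference
    quotients of F in the direction (0, v) are those of F (t, .) in the
    direction v. *)
Lemma D2FE t psi : D2F F t psi = restr (fderiv F (t, psi)).
Proof.
apply/val_inj/funext => v; rewrite /D2F.
have dFt : differentiable (fun y : X => F (t, y)) psi.
  by apply: differentiable_comp; [exact: differentiable_pairr|exact: dF].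
have [_ d1] := is_derive_fderiv v dFt.
have [_ d2] := is_derive_pairr (is_derive_fderiv (0, v) (dF (t, psi))).
exact: etrans (esym d1) d2.
Qed.

Lemma D2F2E t psi v w :
  D2F2 F t psi v w = fderiv (fderiv F) (t, psi) (0, v) (0, w).
Proof.
have dD : differentiable (D2F F t) psi.
  have -> : D2F F t = @restr R X 'cV[R]_n \o (fderiv F \o (fun y => (t, y))).
    by apply/funext => y; rewrite D2FE.
  apply: differentiable_comp.
    by apply: differentiable_comp; [exact: differentiable_pairr|exact: ddF].
  apply: linear_differentiable; exact: restr_continuous.
have [_ d1] := is_derive_ev w (is_derive_fderiv v dD).
have [_ d2] := is_derive_pairr
  (is_derive_ev (0, w) (is_derive_fderiv (0, v) (ddF (t, psi)))).
apply: etrans (esym d1) (etrans _ d2); congr ('D_v _ psi).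
by apply/funext => y; rewrite D2FE.
Qed.

End PartialDerivatives.

Section LocalEstimates.
Context {R : realType} {X : normedModType R} {n : nat}.
Variable F : R * X -> 'cV[R]_n.
Hypothesis dF : forall z, differentiable F z.
Hypothesis ddF : forall z, differentiable (fderiv F) z.
Hypothesis cddF : continuous (fderiv (fderiv F)).

Lemma prod_norm_lt (s t d : R) (phi psi : X) :
  `|t - s| < d -> `|psi - phi| < d -> `|(t, psi) - (s, phi)| < d.
Proof. by move=> ts pp; rewrite prod_normE/= gt_max ts. Qed.

Lemma lineE (t a : R) (psi v : X) :
  (t, psi) + a *: (0, v) = (t, psi + a *: v).
Proof. by congr pair; rewrite /= ?scaler0 ?mulr0 addr0. Qed.

Lemma segment_dist (psi0 psi1 psi2 : X) (r a : R) : 0 <= a <= 1 ->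
  `|psi1 - psi0| <= r -> `|psi2 - psi0| <= r ->
  `|psi2 + a *: (psi1 - psi2) - psi0| <= r.
Proof.
move=> /andP[a0 a1] p1 p2.
have -> : psi2 + a *: (psi1 - psi2) - psi0 =
    a *: (psi1 - psi0) + (1 - a) *: (psi2 - psi0).
  by rewrite scalerBl scale1r addrCA -scalerBr opprB subrKA addrAC.
rewrite (le_trans (ler_normD _ _))// !normrZ !ger0_norm ?subr_ge0//.
have -> : r = a * r + (1 - a) * r by ring.
by rewrite lerD// ler_wpM2l// subr_ge0.
Qed.

(** The derivative of F is continuous, hence bounded near (s0, psi0); balls are
    convex, so the mean value estimate applies on segments. *)
Lemma lipschitz_near (s0 : R) (psi0 : X) : exists r K : R, [/\ 0 < r, 0 < K &
  forall t psi1 psi2, `|t - s0| <= r -> `|psi1 - psi0| <= r ->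
    `|psi2 - psi0| <= r ->
    `|F (t, psi1) - F (t, psi2)| <= K * `|psi1 - psi2|].
Proof.
have cDF : {for (s0, psi0), continuous (fderiv F)}.
  exact: differentiable_continuous.
have /continuous_normP/(_ 1 ltr01)[d d0 dP] := cDF.
exists (d / 2), (`|fderiv F (s0, psi0)| + 1); split.
- by rewrite divr_gt0.
- by rewrite ltr_wpDl.
move=> t psi1 psi2 ts p1 p2; pose v : R * X := (0, psi1 - psi2).
pose g (a : R) := F ((t, psi2) + a *: v).
have gd (a : R) : is_derive a 1 g (fderiv F ((t, psi2) + a *: v) v).
  by apply: is_derive_line; exact: is_derive_fderiv.
have -> : F (t, psi1) = g 1 by rewrite /g lineE scale1r addrC subrK.
have -> : F (t, psi2) = g 0 by rewrite /g lineE scale0r addr0.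
have K0 : 0 <= `|fderiv F (s0, psi0)| + 1 by rewrite addr_ge0.
rewrite -[leRHS]mulr1 -[X in _ <= _ * X](subr0 1).
apply: (mean_value_col (mulr_ge0 K0 (normr_ge0 _)) ler01 (fun a _ => gd a)).
  by apply: continuous_subspaceT => a; apply: is_derive_continuous; exact: gd.
move=> a /andP[/ltW a0 /ltW a1]; rewrite (le_trans (blin_norm_ub _ _))//.
rewrite norm_pair0 ler_wpM2r// lineE.
rewrite -lerBlDl (le_trans (lerB_dist _ _))// dP//.
have dd : d / 2 < d by rewrite ltr_pdivrMr// ltr_pMr// ltr1n.
apply: prod_norm_lt; first exact: le_lt_trans dd.
by apply: le_lt_trans dd; apply: segment_dist; rewrite ?a0.
Qed.

(** By continuity of the second derivative at (s0, psi0), its variation along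
    the segment from psi0 to psi0 + eta is small, uniformly in t near s0; then
    [taylor2_bound] is applied to each coordinate. *)
Lemma taylor2_near (s0 : R) (psi0 : X) (e : R) : 0 < e -> exists2 r : R, 0 < r &
  forall t eta, `|t - s0| <= r -> `|eta| <= r ->
    `|F (t, psi0 + eta) - F (t, psi0) - fderiv F (t, psi0) (0, eta)
      - 2^-1 *: fderiv (fderiv F) (t, psi0) (0, eta) (0, eta)| <= e * `|eta| ^+ 2.
Proof.
move=> e0; have e20 : 0 < e / 2 by rewrite divr_gt0.
have /continuous_normP/(_ _ e20)[d d0 dP] := @cddF (s0, psi0).
have dd : d / 2 < d by rewrite ltr_pdivrMr// ltr_pMr// ltr1n.
exists (d / 2); first by rewrite divr_gt0.
move=> t eta ts er; pose v : R * X := (0, eta); pose z := (t, psi0).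
pose g (a : R) := F (z + a *: v).
pose g1 (a : R) := fderiv F (z + a *: v) v.
pose g2 (a : R) := fderiv (fderiv F) (z + a *: v) v v.
have gd (a : R) : is_derive a 1 g (g1 a).
  by apply: is_derive_line; exact: is_derive_fderiv.
have gd1 (a : R) : is_derive a 1 g1 (g2 a).
  apply: (@is_derive_line _ _ _ (fun y => fderiv F y v)).
  by apply: is_derive_ev; exact: is_derive_fderiv.
have g2P (a : R) : 0 <= a <= 1 -> `|g2 a - g2 0| <= e * `|eta| ^+ 2.
  move=> a01; have near_z (b : R) : 0 <= b <= 1 ->
      `|fderiv (fderiv F) (z + b *: v) - fderiv (fderiv F) (s0, psi0)| <= e / 2.
    move=> /andP[b0 b1]; apply: dP; rewrite lineE; apply: prod_norm_lt.
      exact: le_lt_trans dd.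
    rewrite addrAC subrr add0r normrZ ger0_norm// (le_lt_trans _ dd)//.
    by rewrite (le_trans _ er)// ler_piMl.
  rewrite /g2 -[X in `|X|]/((fderiv (fderiv F) (z + a *: v) -
    fderiv (fderiv F) (z + 0 *: v)) v v).
  rewrite (le_trans (blin_norm_ub _ _))// norm_pair0 expr2 mulrA ler_wpM2r//.
  rewrite (le_trans (blin_norm_ub _ _))// norm_pair0 ler_wpM2r//.
  have -> : e = e / 2 + e / 2 by field.
  rewrite -(subrKA (fderiv (fderiv F) (s0, psi0))) (le_trans (ler_normD _ _))//.
  apply: lerD; first exact: near_z.
  by rewrite distrC; apply: near_z; rewrite lexx ler01.
apply: col_norm_le => [|i]; first by rewrite mulr_ge0 ?exprn_ge0// ltW.
have := @taylor2_bound R (fun a => g a i 0) (fun a => g1 a i 0)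
  (fun a => g2 a i 0) (e * `|eta| ^+ 2).
rewrite /g /g1 /g2 !scale0r !addr0 scale1r !mxE => H; apply: le_trans (H _ _ _).
- by rewrite -[z + v](congr1 (+%R z) (scale1r v)) lineE scale1r.
- by move=> a; exact: (is_derive_colP _ _ _).1 (gd a) i.
- by move=> a; exact: (is_derive_colP _ _ _).1 (gd1 a) i.
- move=> a a01; apply: le_trans (g2P a a01); rewrite /g2 scale0r addr0.
  apply: le_trans (mx_norm_entry _ i 0); by rewrite !mxE.
Qed.

End LocalEstimates.

(** * Local existence for the delay equation *)

Section LocalExistence.
Context {R : realType} {h : R} {n : nat}.
Local Notation X := (hist h n).

(** Picard iteration near a constant history.  The unknown is the restriction
    of x to [s, s + tau], stored as a history of length tau; the fixed point is
    sought in a small ball.  The length tau depends on s0 and on the bounds for F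
    only, and not on s nor on the initial history eta. *)
Lemma local_solution (F : R * X -> 'cV[R]_n) (xbar : 'cV[R]_n) (s0 r K B : R) :
  0 <= h -> 0 < r -> 0 < K -> 0 < B -> continuous F ->
  (forall t psi, `|t - s0| <= r -> `|psi - cst_hist h xbar| <= r ->
    `|F (t, psi)| <= B) ->
  (forall t psi1 psi2, `|t - s0| <= r -> `|psi1 - cst_hist h xbar| <= r ->
    `|psi2 - cst_hist h xbar| <= r ->
    `|F (t, psi1) - F (t, psi2)| <= K * `|psi1 - psi2|) ->
  exists2 tau : R, 0 < tau & forall s (eta : X),
    `|s - s0| <= tau -> `|eta - cst_hist h xbar| <= r / 2 ->
    exists x : R -> 'cV[R]_n, [/\ continuous x, segment h x s = eta,
      forall t, s <= t <= s + tau -> `|segment h x t - cst_hist h xbar| <= r &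
      forall t : R, s < t < s + tau -> is_derive t 1 x (F (t, segment h x t))].
Proof.
move=> h0 r0 K0 B0 cF FB FK.
(* 2 tau <= r keeps times near s0; the other two bounds make the integral
   operator a contraction of ratio 1/2 that maps the ball of radius r / 4 to
   itself. *)
have [tau [tau0 taur tauK tauB]] : exists tau : R,
    [/\ 0 < tau, 2 * tau <= r, 4 * tau * K <= 1 & 4 * tau * B <= r].
  exists (Num.min (r / 2) (Num.min (4 * K)^-1 (r / (4 * B)))).
  have K4 : 0 < 4 * K by rewrite mulr_gt0.
  have B4 : 0 < 4 * B by rewrite mulr_gt0.
  split.
  - by rewrite !lt_min invr_gt0 K4 !divr_gt0.
  - by rewrite mulrC -ler_pdivlMr// ge_min lexx.
  - rewrite mulrAC mulrC -ler_pdivlMr// div1r.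
    by rewrite !ge_min lexx /= !orbT.
  - rewrite mulrAC mulrC -ler_pdivlMr//.
    by rewrite !ge_min lexx /= !orbT.
exists tau => // s eta ss0 etar.
have tau0' := ltW tau0.
pose Y := hist tau n.
(* eta is continued by its last value after s; subtracting y(- tau), the value
   at time s, makes the sum continuous whatever y is. *)
have [xx xxE] : exists xx : Y -> R -> 'cV[R]_n, forall y t, xx y t =
    hext h0 eta (t - s) + (hext tau0' y (t - s - tau) - hext tau0' y (- tau)).
  by exists (fun y t => hext h0 eta (t - s) +
    (hext tau0' y (t - s - tau) - hext tau0' y (- tau))).
have cshift c : continuous (fun t : R => t - c).
  by move=> t; apply: cvgB; [exact: cvg_id|exact: cvg_cst].
have cxx y : continuous (xx y).
  rewrite (funext (xxE y)) => t; apply: cvgD.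
    apply: (@continuous_comp _ _ _ (fun t => t - s) (hext h0 eta)).
      exact: cshift.
    exact: hext_continuous.
  apply: cvgB; last exact: cvg_cst.
  apply: (@continuous_comp _ _ _ (fun t => t - s - tau) (hext tau0' y)).
    apply: (@continuous_comp _ _ _ (fun t => t - s) (fun t => t - tau));
      exact: cshift.
  exact: hext_continuous.
have cg y : continuous (fun t => F (t, segment h (xx y) t)).
  move=> t; apply: (@continuous_comp _ _ _ (fun t => (t, segment h (xx y) t)) F);
    last exact: cF.
  by apply: continuous_pair; [move=> ?; exact: cvg_id|exact: segment_continuous].
have [G GP] := choice (fun y => ex_primitive_col (cg y)).
have cG y : continuous (G y) by move=> t; apply: is_derive_continuous; exact: GP.
have cGs y : continuous (fun t => G y t - G y s).
  by move=> t; apply: cvgB; [exact: cG|exact: cvg_cst].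
(* the integral of the right-hand side from s to s + tau + theta *)
have [Phi PhiE] : exists Phi : Y -> Y, forall y th,
    Phi y th = G y (s + tau + \val th) - G y s.
  exists (fun y => segment tau (fun t => G y t - G y s) (s + tau)) => y th.
  by rewrite (segmentE _ _ (cGs y)).
pose U : set Y := [set y | `|y| <= r / 4].
have xxr y t : U y -> `|segment h (xx y) t - cst_hist h xbar| <= r.
  move=> Uy; apply: hist_norm_le => [|th]; first exact: ltW.
  rewrite histB (segmentE _ _ (cxx y)) xxE addrAC.
  have -> : r = r / 2 + (r / 4 + r / 4) by field.
  apply: (le_trans (ler_normD _ _)); apply: lerD.
    by apply: le_trans etar; exact: (hist_norm_ub (eta - cst_hist h xbar)).
  apply: (le_trans (ler_normB _ _)); apply: lerD;
    by apply: le_trans (Uy); exact: hist_norm_ub.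
have xxK y1 y2 t :
    `|segment h (xx y1) t - segment h (xx y2) t| <= 2 * `|y1 - y2|.
  apply: hist_norm_le => [|th]; first by rewrite mulr_ge0.
  change (`|segment h (xx y1) t th - segment h (xx y2) t th| <= 2 * `|y1 - y2|).
  rewrite [X in `|X - _|](segmentE t th (cxx y1)).
  rewrite [X in `|_ - X|](segmentE t th (cxx y2)).
  rewrite !xxE opprD addrACA subrr add0r.
  rewrite subrACA mulr_natl mulr2n (le_trans (ler_normB _ _))//.
  by rewrite lerD//; exact: (hist_norm_ub (y1 - y2)).
have ts0 t : s <= t <= s + tau -> `|t - s0| <= r.
  move=> /andP[st tst]; move: ss0; rewrite !ler_norml => /andP[s1 s2].
  by apply/andP; split; lra.
have PhiU : set_fun U U Phi.
  move=> y Uy; apply: hist_norm_le => [|th]; first by rewrite divr_ge0// ltW.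
  rewrite PhiE; have /andP[th1 th2] := delays_itv th.
  apply: (@le_trans _ _ (B * (s + tau + \val th - s))).
    apply: (mean_value_col (ltW B0) _ (fun t _ => GP y t)).
    - by lra.
    - exact: continuous_subspaceT.
    - move=> t /andP[t1 t2]; apply: FB; last exact: xxr.
      by apply: ts0; rewrite ltW//=; lra.
  have : B * (s + tau + \val th - s) <= B * tau by rewrite ler_pM2l//; lra.
  by move=> /le_trans; apply; lra.
have q0 : 0 <= 2^-1 :> R by rewrite invr_ge0.
have Phic : is_contraction (mkfun_fun PhiU).
  exists (NngNum q0); split => /=; first by rewrite invf_lt1// ltr1n.
  move=> [y1 y2] [/= U1 U2]; apply: hist_norm_le => [|th]; first by rewrite mulr_ge0.
  change (`|Phi y1 th - Phi y2 th| <= 2^-1 * `|y1 - y2|).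
  rewrite (PhiE y1) (PhiE y2) subrACA; have /andP[th1 th2] := delays_itv th.
  apply: (@le_trans _ _ ((K * (2 * `|y1 - y2|)) * (s + tau + \val th - s))).
    apply: (mean_value_col (f := G y1 - G y2)
      (df := fun t => F (t, segment h (xx y1) t) - F (t, segment h (xx y2) t))).
    - by rewrite !mulr_ge0// ltW.
    - by lra.
    - by apply: continuous_subspaceT => t; apply: cvgB; exact: cG.
    - move=> t /andP[t1 t2]; apply: le_trans (FK _ _ _ _ _ _) _.
      + by apply: ts0; rewrite ltW//=; lra.
      + exact: xxr.
      + exact: xxr.
      + by rewrite ler_pM2l.
  rewrite mulrA mulrAC ler_wpM2r//.
  have : K * 2 * (s + tau + \val th - s) <= K * 2 * tau.
    by rewrite ler_pM2l ?mulr_gt0//; lra.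
  by move=> /le_trans; apply; lra.
have clU : closed U.
  have -> : U = closed_ball (0 : Y) (r / 4).
    rewrite closed_ballE ?divr_gt0//; apply/seteqP; split => y;
      by rewrite /U /closed_ball_/= sub0r normrN.
  exact: closed_ball_closed.
have U0 : U !=set0 by exists 0; rewrite /U/= normr0 divr_ge0// ltW.
have [y Uy yE] := banach_fixed_point Phic clU U0.
have {}yE th : y th = G y (s + tau + \val th) - G y s by rewrite {1}yE /= PhiE.
have yt : hext tau0' y (- tau) = 0.
  rewrite /hext yE /=; rewrite (min_idPl _) ?oppr_le0// (max_idPl (lexx _)).
  by rewrite addrK subrr.
exists (xx y); split => //.
- apply/val_inj/funext => th; rewrite [LHS](segmentE _ _ (cxx y)) xxE.
  have /andP[th1 th2] := delays_itv th.
  rewrite addrAC subrr add0r (_ : hext tau0' y (\val th - tau) = 0) ?yt.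
    by rewrite subrr addr0 /hext (clamp_id _ (erefl _)).
  by rewrite /hext clamp_le; [exact: yt|lra].
- by move=> t _; exact: xxr.
- move=> t /andP[st tst].
  pose f t' := G y t' + (hext h0 eta 0 - G y s).
  have df : is_derive t 1 f (F (t, segment h (xx y) t)).
    have := is_deriveD (GP y t) (is_derive_cst (hext h0 eta 0 - G y s) t 1).
    by rewrite addr0.
  have fxx : \near t, f t = xx y t.
    near=> t'.
    have st' : s < t' by near: t'; exact: lt_nbhsr.
    have tst' : t' < s + tau by near: t'; exact: lt_nbhsl.
    have -> : xx y t' = hext h0 eta 0 + (G y t' - G y s).
      rewrite xxE yt subr0 {1}/hext clamp_ge ?subr_ge0 1?ltW//; congr (_ + _).
      rewrite /hext yE /= (min_idPl _); last by lra.
      by rewrite (max_idPr _); [congr (G y _ - _); ring|lra].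
    by rewrite /f addrCA.
  exact: near_eq_is_derive fxx df.
Unshelve. all: by end_near. Qed.

End LocalExistence.

(** * Stieltjes integrals and the characteristic matrix *)

Section StieltjesTheory.
Context {R : realType} {K : numFieldType}.

Lemma itv_partition_nodes (a b : R) (s : seq R) (i : nat) :
  itv_partition a b s -> (i <= size s)%N -> a <= nth b (a :: s) i <= b.
Proof.
move=> sP si; rewrite itv_partition_nth_ge//=; exact: itv_partition_nth_le.
Qed.

(** The uniform partition. *)
Lemma ex_fine_partition (a b d : R) : a < b -> 0 < d ->
  exists2 s : seq R, itv_partition a b s &
    forall i, (i < size s)%N ->
      0 <= nth b (a :: s) i.+1 - nth b (a :: s) i < d.
Proof.
move=> ab d0; have [N Nd] : exists N : nat, (b - a) / d < N.+1%:R.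
  by exists (Num.bound ((b - a) / d)); rewrite (lt_trans (archi_boundP _))// ?divr_ge0 ?subr_ge0 ?ltW// ltr_nat.
pose w := (b - a) / N.+1%:R.
have w0 : 0 < w by rewrite divr_gt0// subr_gt0.
have wd : w < d by rewrite ltr_pdivrMr// mulrC -ltr_pdivrMr.
pose x (i : nat) := a + i%:R * w.
have xS i : x i.+1 - x i = w.
  by rewrite /x -[i.+1]addn1 natrD; ring.
have x0 : x 0%N = a by rewrite /x mul0r addr0.
have xN : x N.+1 = b by rewrite /x /w mulrC divfK ?pnatr_eq0// addrC subrK.
have [s sizes nthE] : exists2 s : seq R, size s = N.+1 &
    forall i, (i <= N.+1)%N -> nth b (a :: s) i = x i.
  exists [seq x i | i <- iota 1 N.+1]; first by rewrite size_map size_iota.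
  move=> [|i] iN; first by rewrite x0.
  rewrite -[LHS]/(nth b [seq x i | i <- iota 1 N.+1] i).
  by rewrite (nth_map 0%N) ?size_iota// nth_iota.
exists s; last first.
  move=> i; rewrite sizes => iN.
  by rewrite (nthE i.+1 iN) (nthE i (ltnW iN)) xS ltW.
split.
  apply/(pathP b) => i; rewrite sizes => iN.
  rewrite -[nth b s i]/(nth b (a :: s) i.+1) (nthE i.+1 iN) (nthE i (ltnW iN)).
  by rewrite -subr_gt0 xS.
by rewrite (last_nth b) sizes (nthE _ (leqnn _)) xN.
Qed.

(** Two limits of the sums are compared on one partition that is fine enough
    for both. *)
Lemma is_stieltjes_unique (n m : nat) (a b : R) (zeta : R -> 'M[K]_n)
    (f : R -> 'M[K]_(n, m)) (u v : 'M[K]_(n, m)) : a < b ->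
  is_stieltjes a b zeta f u -> is_stieltjes a b zeta f v -> u = v.
Proof.
move=> ab fu fv; apply/eqP; rewrite -subr_eq0 -normr_eq0; apply/negP => /negP uv.
have e0 : 0 < `|u - v| / 2 by rewrite divr_gt0// lt_def uv/=.
have [d1 d10 P1] := fu _ e0; have [d2 d20 P2] := fv _ e0.
have d0 : 0 < Num.min d1 d2 by rewrite lt_min d10.
have [s sP sd] := ex_fine_partition ab d0.
pose tau i := nth b (a :: s) i.
have st (d : R) : Num.min d1 d2 <= d -> forall i, (i < size s)%N ->
    nth b (a :: s) i <= tau i <= nth b (a :: s) i.+1 /\
    nth b (a :: s) i.+1 - nth b (a :: s) i < d.
  move=> dd i /sd /andP[sd1 sd2]; split; last exact: lt_le_trans dd.
  by rewrite lexx -subr_ge0.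
have := P1 s tau sP (st _ _); rewrite ge_min lexx => /(_ isT) H1.
have := P2 s tau sP (st _ _); rewrite ge_min lexx orbT => /(_ isT) H2.
have := ltrD H1 H2; rewrite -splitr distrC.
have := ler_normD (u - stieltjes_sum a b zeta f s tau) (stieltjes_sum a b zeta f s tau - v).
by rewrite subrKA => /le_lt_trans H /H; rewrite ltxx.
Qed.

Lemma stieltjesE (n m : nat) (a b : R) (zeta : R -> 'M[K]_n)
    (f : R -> 'M[K]_(n, m)) (v : 'M[K]_(n, m)) : a < b ->
  is_stieltjes a b zeta f v -> stieltjes a b zeta f = v.
Proof.
move=> ab fv; apply: (is_stieltjes_unique ab _ fv).
by rewrite /stieltjes; case: xgetP => [y _ //|/(_ v)].
Qed.

Lemma is_stieltjes_ext (n m : nat) (a b : R) (zeta : R -> 'M[K]_n)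
    (f g : R -> 'M[K]_(n, m)) (v : 'M[K]_(n, m)) :
  (forall t, a <= t <= b -> f t = g t) ->
  is_stieltjes a b zeta f v -> is_stieltjes a b zeta g v.
Proof.
move=> fg fv e e0; have [d d0 dP] := fv e e0; exists d => // s tau sP st.
rewrite (_ : stieltjes_sum _ _ _ _ _ _ = stieltjes_sum a b zeta f s tau); first exact: dP.
apply: eq_big_nat => i /andP[_ si]; rewrite fg//.
have [/andP[t1 t2] _] := st i si.
have /andP[s1 _] := itv_partition_nodes sP (ltnW si).
have /andP[_ s2] := itv_partition_nodes sP si.
by rewrite (le_trans s1)//= (le_trans t2).
Qed.

(** The smallest of the mesh bounds of the columns serves for the matrix. *)
Lemma is_stieltjes_cols (n m : nat) (a b : R) (zeta : R -> 'M[K]_n)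
    (f : R -> 'M[K]_(n, m)) (v : 'M[K]_(n, m)) :
  (forall j, is_stieltjes a b zeta (fun t => col j (f t)) (col j v)) ->
  is_stieltjes a b zeta f v.
Proof.
move=> fv e e0; have e20 : 0 < e / 2 by rewrite divr_gt0.
have [d dP] := choice (fun j => (exists2P _ _).1 (fv j _ e20)).
pose d0 := \big[Num.min/1]_j d j.
exists d0.
  by apply/bigmin_gtP; split => // j _; have [] := dP j.
move=> s tau sP st; apply: (@le_lt_trans _ _ (e / 2)); last first.
  by rewrite ltr_pdivrMr// ltr_pMr// ltr1n.
apply: mx_norm_le => [|i j]; first exact: ltW.
have [_ /(_ s tau sP)] := dP j.
have sj : forall i, (i < size s)%N ->
    nth b (a :: s) i <= tau i <= nth b (a :: s) i.+1 /\
    nth b (a :: s) i.+1 - nth b (a :: s) i < d j.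
  move=> k /st[t1 t2]; split => //; apply: lt_le_trans t2 _.
  exact: bigmin_le.
move=> /(_ sj)/ltW; apply: le_trans.
have -> : stieltjes_sum a b zeta (fun t => col j (f t)) s tau =
    col j (stieltjes_sum a b zeta f s tau).
  rewrite /stieltjes_sum; apply/matrixP => k l; rewrite !mxE !summxE.
  by apply: eq_bigr => k' _; rewrite !mxE; apply: eq_bigr => l' _; rewrite !mxE.
apply: le_trans (mx_norm_entry _ i 0).
by rewrite !mxE.
Qed.

End StieltjesTheory.

Section ComplexMatrix.
Context {R : realType} {m n : nat}.

(** The complex matrix U + i V. *)
Definition cmx (U V : 'M[R]_(m, n)) : 'M[R[i]]_(m, n) :=
  map_mx (real_complex R) U + 'i%C *: map_mx (real_complex R) V.

Lemma cmxE (U V : 'M[R]_(m, n)) i j : cmx U V i j = (U i j +i* V i j)%C.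
Proof.
rewrite !mxE; apply/eqP; rewrite eq_complex/=.
by rewrite !mul0r !mul1r subrr !(addr0, add0r) !eqxx.
Qed.

Lemma complex_norm_le (u v : R) : `|(u +i* v)%C : R[i]| <= (`|u| + `|v|)%:C%C.
Proof.
rewrite normc_def/= lecR -[leRHS]ger0_norm ?addr_ge0// -sqrtr_sqr ler_sqrt ?sqr_ge0//.
have uv : 0 <= `|u| * `|v| by rewrite mulr_ge0.
rewrite -(real_normK (num_real u)) -(real_normK (num_real v)) sqrrD.
by rewrite addrAC lerDl mulrn_wge0.
Qed.

Lemma complexNE (x : R[i]) : x = (complex.Re x +i* complex.Im x)%C.
Proof. by case: x. Qed.

Lemma cmx_norm_le (U V : 'M[R]_(m, n)) : `|cmx U V| <= (`|U| + `|V|)%:C%C.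
Proof.
apply: mx_norm_le => [|i j]; first by rewrite lecR addr_ge0.
rewrite cmxE (le_trans (complex_norm_le _ _))// lecR.
by rewrite lerD// mx_norm_entry.
Qed.

Lemma cmxB (U V U' V' : 'M[R]_(m, n)) :
  cmx U V - cmx U' V' = cmx (U - U') (V - V').
Proof. by rewrite /cmx !map_mxB scalerBr opprD addrACA. Qed.

Lemma cmx_sum (I : Type) (r : seq I) (P : pred I) (U V : I -> 'M[R]_(m, n)) :
  \sum_(i <- r | P i) cmx (U i) (V i) =
  cmx (\sum_(i <- r | P i) U i) (\sum_(i <- r | P i) V i).
Proof. by rewrite big_split/= /cmx !raddf_sum. Qed.

End ComplexMatrix.

Section ComplexStieltjes.
Context {R : realType}.

Lemma cmx_mul_map (m k l : nat) (U V : 'M[R]_(m, k)) (A : 'M[R]_(k, l)) :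
  cmx U V *m map_mx (real_complex R) A = cmx (U *m A) (V *m A).
Proof. by rewrite /cmx mulmxDl -scalemxAl !map_mxM. Qed.

Lemma map_mul_cmx (m k l : nat) (A : 'M[R]_(m, k)) (U V : 'M[R]_(k, l)) :
  map_mx (real_complex R) A *m cmx U V = cmx (A *m U) (A *m V).
Proof. by rewrite /cmx mulmxDr -scalemxAr !map_mxM. Qed.

Lemma cmx_eq0_re (m k : nat) (U V : 'M[R]_(m, k)) : cmx U V = 0 -> U = 0.
Proof.
move=> /matrixP UV; apply/matrixP => i j; have := UV i j.
by rewrite cmxE !mxE => -[].
Qed.

Lemma is_stieltjes_complex (n m : nat) (a b : R) (zeta : R -> 'M[R]_n)
    (f g : R -> 'M[R]_(n, m)) (u v : 'M[R]_(n, m)) :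
  is_stieltjes a b zeta f u -> is_stieltjes a b zeta g v ->
  is_stieltjes a b (fun t => map_mx (real_complex R) (zeta t))
    (fun t => cmx (f t) (g t)) (cmx u v).
Proof.
move=> fu gv e; rewrite [e]complexNE ltcE/= => /andP[/eqP e0 eR].
set r := complex.Re e in eR *.
have r20 : 0 < r / 2 by rewrite divr_gt0.
have [d1 d10 P1] := fu _ r20; have [d2 d20 P2] := gv _ r20.
have d0 : 0 < Num.min d1 d2 by rewrite lt_min d10.
exists (Num.min d1 d2) => // s tau sP st.
have -> : stieltjes_sum a b (fun t => map_mx (real_complex R) (zeta t))
    (fun t => cmx (f t) (g t)) s tau =
    cmx (stieltjes_sum a b zeta f s tau) (stieltjes_sum a b zeta g s tau).
  rewrite /stieltjes_sum -cmx_sum; apply: eq_bigr => i _.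
  by rewrite -map_mxB map_mul_cmx.
rewrite cmxB (le_lt_trans (cmx_norm_le _ _))// e0 ltcE/= eqxx/=.
rewrite (splitr r) ltrD//; [apply: P1|apply: P2] => // i /st[t1 t2]; split=> //;
  apply: lt_le_trans t2 _; by rewrite ge_min lexx ?orbT.
Qed.

End ComplexStieltjes.

Section ExpTrig.
Context {R : realType}.

(** The real span of the real and imaginary parts of exp ((al + i be) t),
    which is stable under differentiation. *)
Definition exptrig (al be c1 c2 t : R) : R :=
  expR (al * t) * (c1 * cos (be * t) + c2 * sin (be * t)).

Lemma is_derive_exptrig (al be c1 c2 t : R) :
  is_derive t 1 (exptrig al be c1 c2)
    (exptrig al be (al * c1 + be * c2) (al * c2 - be * c1) t).
Proof.
have lin (a : R) : is_derive t 1 (fun s : R => a * s) a.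
  by have := is_deriveZ a (is_derive_id t (1 : R)); rewrite /GRing.scale/= mulr1.
have dE := is_derive1_comp (is_derive_expR (al * t)) (lin al).
have dC := is_deriveZ c1 (is_derive1_comp (is_derive_cos (be * t)) (lin be)).
have dS := is_deriveZ c2 (is_derive1_comp (is_derive_sin (be * t)) (lin be)).
apply: (is_derive_eq (is_deriveM dE (is_deriveD dC dS))).
rewrite -[(_ \*: _ + _ \*: _) t]/(c1 * cos (be * t) + c2 * sin (be * t)).
by rewrite /exptrig /GRing.scale/=; ring.
Qed.

Lemma exptrig_bound (al be c1 c2 m t : R) : `|al| <= m -> 0 <= t <= 1 ->
  `|exptrig al be c1 c2 t| <= expR m * (`|c1| + `|c2|).
Proof.
move=> am /andP[t0 t1]; rewrite normrM ger0_norm ?expR_ge0//.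
apply: ler_pM; rewrite ?expR_ge0 ?normr_ge0//.
  rewrite ler_expR (le_trans (ler_norm _))// normrM (ger0_norm t0).
  by rewrite (le_trans _ am)// ler_piMr.
rewrite (le_trans (ler_normD _ _))// !normrM lerD// ler_piMr//.
  exact: cos_max.
exact: sin_max.
Qed.

(** First-order expansion at 0, evaluated at t = 1.  The second derivative is
    bounded by 8 m^2 e^m; the constant 20 is 16, for its oscillation, plus 4, for
    half of its value at 0. *)
Lemma exptrig_taylor (al be c1 c2 m : R) :
  `|al| <= m -> `|be| <= m -> `|c1| <= 1 -> `|c2| <= 1 ->
  `|exptrig al be c1 c2 1 - c1 - (al * c1 + be * c2)| <= 20 * m ^+ 2 * expR m.
Proof.
move=> am bm c1m c2m; have m0 : 0 <= m by apply: le_trans am.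
set c1' := al * c1 + be * c2; pose c2' := al * c2 - be * c1.
have prodm (x y u v : R) : 0 <= u -> 0 <= v -> `|x| <= u -> `|y| <= v -> `|x * y| <= u * v.
  by move=> u0 v0 xu yv; rewrite normrM ler_pM.
have c1'm : `|c1'| <= 2 * m.
  rewrite (le_trans (ler_normD _ _))// mulr_natl mulr2n lerD//.
    by rewrite -[leRHS]mulr1 prodm.
  by rewrite -[leRHS]mulr1 prodm.
have c2'm : `|c2'| <= 2 * m.
  rewrite (le_trans (ler_normB _ _))// mulr_natl mulr2n lerD//.
    by rewrite -[leRHS]mulr1 prodm.
  by rewrite -[leRHS]mulr1 prodm.
pose c1'' := al * c1' + be * c2'; pose c2'' := al * c2' - be * c1'.
have mm : 0 <= 2 * m by rewrite mulr_ge0.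
have c1''m : `|c1''| <= 4 * m ^+ 2.
  have -> : 4 * m ^+ 2 = m * (2 * m) + m * (2 * m) by ring.
  by rewrite (le_trans (ler_normD _ _))// lerD// prodm.
have c2''m : `|c2''| <= 4 * m ^+ 2.
  have -> : 4 * m ^+ 2 = m * (2 * m) + m * (2 * m) by ring.
  by rewrite (le_trans (ler_normB _ _))// lerD// prodm.
pose f2 := exptrig al be c1'' c2''.
have f2m (t : R) : 0 <= t <= 1 -> `|f2 t| <= 8 * m ^+ 2 * expR m.
  move=> t01; apply: le_trans (exptrig_bound _ _ _ am t01) _.
  rewrite mulrC ler_wpM2r ?expR_ge0//.
  have -> : 8 * m ^+ 2 = 4 * m ^+ 2 + 4 * m ^+ 2 by ring.
  exact: lerD.
have f20 : `|f2 0| <= 8 * m ^+ 2 * expR m by apply: f2m; rewrite lexx ler01.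
have := @taylor2_bound R (exptrig al be c1 c2) (exptrig al be c1' c2') f2
  (16 * m ^+ 2 * expR m).
have ex0 d1 d2 : exptrig al be d1 d2 0 = d1.
  by rewrite /exptrig !mulr0 expR0 cos0 sin0; ring.
rewrite !ex0 => H.
have {}H : `|exptrig al be c1 c2 1 - c1 - c1' - 2^-1 * f2 0| <= 16 * m ^+ 2 * expR m.
  apply: H => [t|t|t t01]; [exact: is_derive_exptrig|exact: is_derive_exptrig|].
  rewrite (le_trans (ler_normB _ _))//.
  have -> : 16 * m ^+ 2 * expR m = 8 * m ^+ 2 * expR m + 8 * m ^+ 2 * expR m by ring.
  by rewrite lerD// f2m.
rewrite -[X in `|X|](subrK (2^-1 * f2 0)) (le_trans (ler_normD _ _))//.
have -> : 20 * m ^+ 2 * expR m = 16 * m ^+ 2 * expR m + 2^-1 * (8 * m ^+ 2 * expR m).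
  by field.
by rewrite lerD// normrM ger0_norm ?invr_ge0// ler_wpM2l// invr_ge0.
Qed.

End ExpTrig.

Section LinearPart.
Context {R : realType} {h : R} {n : nat}.
Local Notation X := (hist h n).
Variables (L : blin X 'cV[R]_n) (zeta : R -> 'M[R]_n).
Hypothesis h_gt0 : 0 < h.
Hypothesis zeta_L : represents zeta L.

(** The history with value c (- theta) v at theta. *)
Definition dhist (c : R -> R) (v : 'cV[R]_n) : X :=
  segment h (fun t => c (- t) *: v) 0.

Lemma dhistE (c : R -> R) (v : 'cV[R]_n) (th : set_type `[- h, 0]%classic) :
  continuous c -> dhist c v th = c (- \val th) *: v.
Proof.
move=> cc; rewrite /dhist segmentE ?add0r// => t; apply: cvgZr_tmp.
apply: (@continuous_comp _ _ _ -%R c); last exact: cc.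
exact: opp_continuous.
Qed.

Lemma stieltjes_dhist (c : R -> R) (v : 'cV[R]_n) : continuous c ->
  is_stieltjes 0 h zeta (fun t => c t *: v) (L (dhist c v)).
Proof.
move=> cc; apply: is_stieltjes_ext (zeta_L (dhist c v)) => t /andP[t0 th].
have mem : - t \in `[- h, 0]%classic.
  by rewrite inE /= in_itv/= lerN2 th oppr_le0.
pose s : set_type `[- h, 0]%classic := exist (fun x => x \in _) _ mem.
have := congr1 (fun g => g s) (valLK 0 (hist_fun (dhist c v))).
rewrite dhistE// /= opprK => <-.
by [].
Qed.

(** The integral of c(theta) I against dzeta.  Its columns are values of L, so
    the representation of L provides the existence of this integral. *)
Definition Lmx (c : R -> R) : 'M[R]_n :=
  \matrix_(i, j) L (dhist c (delta_mx j 0)) i 0.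

Lemma stieltjes_Lmx (c : R -> R) : continuous c ->
  is_stieltjes 0 h zeta (fun t => (c t)%:M) (Lmx c).
Proof.
move=> cc; apply: is_stieltjes_cols => j.
have -> : col j (Lmx c) = L (dhist c (delta_mx j 0)).
  by apply/colP => i; rewrite !mxE.
have -> : (fun t => col j (c t)%:M) = (fun t => c t *: delta_mx j 0).
  apply/funext => t; apply/colP => i; rewrite !mxE eqxx andbT.
  by rewrite mulr_natr eq_sym.
exact: stieltjes_dhist.
Qed.

Lemma blin_sum (I : Type) (r : seq I) (P : pred I) (f : I -> X) :
  L (\sum_(i <- r | P i) f i) = \sum_(i <- r | P i) L (f i).
Proof. by apply: (big_morph L (@blinD _ _ _ L)); exact: blin0. Qed.

Lemma hist_sum (I : Type) (r : seq I) (P : pred I) (f : I -> X) th :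
  (\sum_(i <- r | P i) f i) th = \sum_(i <- r | P i) f i th.
Proof. exact: (big_morph (fun g : X => g th)). Qed.

Lemma Lmx_mul (c : R -> R) (v : 'cV[R]_n) : continuous c ->
  Lmx c *m v = L (dhist c v).
Proof.
move=> cc.
have -> : dhist c v = \sum_j v j 0 *: dhist c (delta_mx j 0).
  apply/val_inj/funext => th; change (dhist c v th = (\sum_j v j 0 *: dhist c (delta_mx j 0)) th).
  rewrite hist_sum (dhistE _ _ cc) {1}[v]matrix_sum_delta scaler_sumr.
  apply: eq_bigr => j _; rewrite big_ord1 histZ (dhistE _ _ cc).
  by rewrite !scalerA mulrC.
rewrite blin_sum; apply/colP => i; rewrite !mxE summxE; apply: eq_bigr => j _.
by rewrite blinZ !mxE mulrC.
Qed.

(** The boundedness of L yields uniform estimates for these integrals. *)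
Lemma Lmx_comb_norm (c c0 c1 : R -> R) (a C : R) :
  continuous c -> continuous c0 -> continuous c1 -> 0 <= C ->
  (forall t, 0 <= t <= h -> `|c t - c0 t + a * c1 t| <= C) ->
  `|Lmx c - Lmx c0 + a *: Lmx c1| <= `|L| * C.
Proof.
move=> cc cc0 cc1 C0 cC; apply: mx_norm_le => [|i j]; first by rewrite mulr_ge0.
have -> : (Lmx c - Lmx c0 + a *: Lmx c1) i j =
    L (dhist c (delta_mx j 0) - dhist c0 (delta_mx j 0) + a *: dhist c1 (delta_mx j 0)) i 0.
  by rewrite blinD blinB blinZ !mxE.
rewrite (le_trans (mx_norm_entry _ _ _))// (le_trans (blin_norm_ub _ _))//.
rewrite ler_wpM2l//; apply: hist_norm_le => // th.
change (`|dhist c (delta_mx j 0) th - dhist c0 (delta_mx j 0) th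
  + a *: dhist c1 (delta_mx j 0) th| <= C).
rewrite [X in `|X - _ + _|](dhistE _ _ cc) [X in `|_ - X + _|](dhistE _ _ cc0).
rewrite [X in `|_ + _ *: X|](dhistE _ _ cc1).
rewrite scalerA -scalerBl -scalerDl normrZ -[leRHS]mulr1.
apply: ler_pM => //.
  by apply: cC; have /andP[t1 t2] := delays_itv th; lra.
by apply: col_norm_le => // k; rewrite mxE; case: eqP; rewrite ?normr1 ?normr0 ?andbF//; case: eqP => //; rewrite ?normr1 ?normr0.
Qed.

(** The real part of exp (- z t); [cim] is the imaginary part. *)
Definition cre (z : R[i]) (t : R) : R :=
  exptrig (- (complex.Re z * t)) (- (complex.Im z * t)) 1 0 1.
Definition cim (z : R[i]) (t : R) : R :=
  exptrig (- (complex.Re z * t)) (- (complex.Im z * t)) 0 1 1.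

Lemma exptrig_continuous (a b c1 c2 : R) :
  continuous (fun t => exptrig (- (a * t)) (- (b * t)) c1 c2 1).
Proof.
have -> : (fun t => exptrig (- (a * t)) (- (b * t)) c1 c2 1) =
          exptrig (- a) (- b) c1 c2.
  by apply/funext => t; rewrite /exptrig !mulr1 !mulNr.
by move=> t; apply: is_derive_continuous; exact: is_derive_exptrig.
Qed.

Lemma charmxE (z : R[i]) : charmx h zeta z =
  cmx ((complex.Re z)%:M - Lmx (cre z)) ((complex.Im z)%:M - Lmx (cim z)).
Proof.
rewrite /charmx (stieltjesE h_gt0 (v := cmx (Lmx (cre z)) (Lmx (cim z)))).
  rewrite -cmxB; congr (_ - _); apply/matrixP => i j; rewrite cmxE !mxE.
  by case: (i == j); rewrite ?mulr1n ?mulr0n//; case: z.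
have := is_stieltjes_complex (stieltjes_Lmx (@exptrig_continuous (complex.Re z) (complex.Im z) 1 0))
  (stieltjes_Lmx (@exptrig_continuous (complex.Re z) (complex.Im z) 0 1)).
apply: is_stieltjes_ext => t _; apply/matrixP => i j; rewrite cmxE !mxE.
case: (i == j); rewrite ?mulr1n ?mulr0n//.
rewrite /exptrig /cexp !mulr1 !mul1r !mul0r addr0 add0r.
by case: z => a b /=; rewrite !mulr0 subr0 add0r !mulNr.
Qed.

End LinearPart.

Section CharacteristicDerivative.
Context {R : realType} {h : R} {n : nat}.
Local Notation X := (hist h n).
Variables (L : blin X 'cV[R]_n) (zeta : R -> 'M[R]_n).
Hypothesis h_gt0 : 0 < h.
Hypothesis zeta_L : represents zeta L.

Lemma cre0 : cre 0 = (fun=> 1 : R).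
Proof.
apply/funext => t; change (exptrig (- (0 * t)) (- (0 * t)) 1 0 1 = 1).
by rewrite /exptrig !mul0r oppr0 mul0r expR0 cos0 addr0 !mulr1.
Qed.

Lemma cim0 : cim 0 = (fun=> 0 : R).
Proof.
apply/funext => t; change (exptrig (- (0 * t)) (- (0 * t)) 0 1 1 = 0).
by rewrite /exptrig !mul0r oppr0 mul0r sin0 !mulr0 ?addr0 ?mulr0.
Qed.

Lemma cre_cim_bound (z : R[i]) (d t : R) : 0 <= t <= h -> d <= 1 ->
  `|complex.Re z| <= d -> `|complex.Im z| <= d ->
  `|cre z t - cre 0 t + complex.Re z * t| <= 20 * h ^+ 2 * expR h * d ^+ 2 /\
  `|cim z t - cim 0 t + complex.Im z * t| <= 20 * h ^+ 2 * expR h * d ^+ 2.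
Proof.
case: z => a b /= /andP[t0 th] d1 ad bd; have d0 : 0 <= d by apply: le_trans ad.
have h0 := ltW h_gt0.
have hd (x : R) : `|x| <= d -> `|- (x * t)| <= h * d.
  by move=> xd; rewrite normrN normrM mulrC ler_pM// ger0_norm.
have K : 20 * (h * d) ^+ 2 * expR (h * d) <= 20 * h ^+ 2 * expR h * d ^+ 2.
  rewrite exprMn mulrA mulrAC ler_wpM2r ?exprn_ge0// ler_wpM2l//.
    by rewrite mulr_ge0// exprn_ge0.
  by rewrite ler_expR ler_piMr.
rewrite cre0 cim0; split; apply: le_trans K.
  have -> : cre (a +i* b)%C t - 1 + a * t = exptrig (- (a * t)) (- (b * t)) 1 0 1
      - 1 - (- (a * t) * 1 + - (b * t) * 0).
    by rewrite /cre/=; ring.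
  by apply: exptrig_taylor; rewrite ?hd ?normr1 ?normr0.
have -> : cim (a +i* b)%C t - 0 + b * t = exptrig (- (a * t)) (- (b * t)) 0 1 1
    - 0 - (- (a * t) * 0 + - (b * t) * 1).
  by rewrite /cim/=; ring.
by apply: exptrig_taylor; rewrite ?hd ?normr1 ?normr0.
Qed.

Lemma cre_continuous (z : R[i]) : continuous (cre z).
Proof. exact: exptrig_continuous. Qed.

Lemma cim_continuous (z : R[i]) : continuous (cim z).
Proof. exact: exptrig_continuous. Qed.

(** Under the integral, exp (- z theta) is replaced by 1 - z theta with an
    error O(|z|^2) that is uniform in theta. *)
Lemma charmx_taylor (z : R[i]) (d : R) : d <= 1 ->
  `|complex.Re z| <= d -> `|complex.Im z| <= d ->
  `|charmx h zeta z - charmx h zeta 0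
     - z *: map_mx (real_complex R) (1%:M + Lmx L id)|
  <= (2 * (`|L| * (20 * h ^+ 2 * expR h * d ^+ 2)))%:C%C.
Proof.
move=> d1 ad bd; set C := 20 * h ^+ 2 * expR h * d ^+ 2.
have C0 : 0 <= C.
  by apply: mulr_ge0 (sqr_ge0 d); apply: mulr_ge0 (expR_ge0 h); apply: mulr_ge0 (sqr_ge0 h).
have hz : z *: map_mx (real_complex R) (1%:M + Lmx L id) =
    cmx (complex.Re z *: (1%:M + Lmx L id)) (complex.Im z *: (1%:M + Lmx L id)).
  apply/matrixP => i j; rewrite cmxE !mxE; case: z {ad bd} => a b /=.
  by apply/eqP; rewrite eq_complex/= !mulr0 subr0 add0r !eqxx.
rewrite (charmxE h_gt0 zeta_L z) (charmxE h_gt0 zeta_L 0) hz !cmxB.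
apply: le_trans (cmx_norm_le _ _) _; rewrite lecR mulr_natl mulr2n.
have idc : continuous (id : R -> R) by move=> ?; exact: cvg_id.
have E (a : R) (M M0 M1 : 'M[R]_n) :
    `|a%:M - M - (0%:M - M0) - a *: (1%:M + M1)| = `|M - M0 + a *: M1|.
  rewrite -normrN; congr (`|_|); apply/matrixP => i j; rewrite !mxE.
  by case: (i == j); rewrite ?mulr1n ?mulr0n; ring.
apply: lerD; rewrite E; apply: Lmx_comb_norm => //.
- exact: cre_continuous.
- exact: cre_continuous.
- by move=> t th; have [] := cre_cim_bound th d1 ad bd.
- exact: cim_continuous.
- exact: cim_continuous.
- by move=> t th; have [] := cre_cim_bound th d1 ad bd.
Qed.

(** Difference quotients of complex increments z, by [charmx_taylor] with
    d = |z|. *)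
Lemma charmx_derive1 :
  derive1 (charmx h zeta) 0 = map_mx (real_complex R) (1%:M + Lmx L id).
Proof.
set D := map_mx _ _; apply: cvg_lim => //.
apply/cvgrPdist_le => e; rewrite [e]complexNE ltcE/= => /andP[/eqP e0 eR].
set r := complex.Re e in eR *.
pose C := 2 * (`|L| * (20 * h ^+ 2 * expR h)).
have C0 : 0 <= C.
  apply: mulr_ge0 => //; apply: mulr_ge0 => //.
  by apply: mulr_ge0 (expR_ge0 h); apply: mulr_ge0 (sqr_ge0 h).
have C1 : 0 < C + 1 by rewrite ltr_wpDl.
pose d0 := Num.min 1 (r / (C + 1)).
have d00 : 0 < d0 by rewrite lt_min ltr01 divr_gt0.
have dc0 : (0 : R[i]) < d0%:C%C by rewrite ltcR.
near=> z.
have z0 : z != 0 by near: z; exact: withinT.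
have nz : `|z| < d0%:C%C by near: z; exact: (@dnbhs0_lt R[i] R[i]^o).
pose d := Num.sqrt (complex.Re z ^+ 2 + complex.Im z ^+ 2).
have zd : `|z| = d%:C%C by rewrite normc_def.
have d_gt0 : 0 < d by rewrite -ltcR -zd normr_gt0.
have dd0 : d < d0 by rewrite -ltcR -zd.
have d1 : d <= 1 by rewrite (le_trans (ltW dd0))// ge_min lexx.
have ad : `|complex.Re z| <= d.
  by rewrite -sqrtr_sqr ler_wsqrtr// lerDl sqr_ge0.
have bd : `|complex.Im z| <= d.
  by rewrite -sqrtr_sqr ler_wsqrtr// lerDr sqr_ge0.
have := charmx_taylor d1 ad bd; rewrite -/D => H.
rewrite addr0 distrC.
have -> : z^-1 *: (charmx h zeta z - charmx h zeta 0) - D =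
    z^-1 *: (charmx h zeta z - charmx h zeta 0 - z *: D).
  by rewrite [RHS]scalerBr scalerA mulVf// scale1r.
rewrite normrZ normfV zd mulrC ler_pdivrMr ?ltcR//.
apply: le_trans H _.
rewrite [e]complexNE e0 -/r -[(r +i* 0)%C]/(r%:C%C) -rmorphM lecR/=.
have -> : 2 * (`|L| * (20 * h ^+ 2 * expR h * d ^+ 2)) = C * d * d.
  by rewrite /C; ring.
apply: ler_wpM2r; first exact: ltW.
have : (C + 1) * d <= r.
  rewrite mulrC -ler_pdivlMr//; apply: le_trans (ltW dd0) _.
  by rewrite ge_min lexx orbT.
by move=> Cd; apply: le_trans Cd; rewrite ler_wpM2r ?lerDl// ltW.
Unshelve. all: by end_near. Qed.

Lemma dhist_cre0 (v : 'cV[R]_n) : dhist (cre 0) v = cst_hist h v.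
Proof.
apply/val_inj/funext => th; rewrite [LHS](dhistE _ _ (@cre_continuous 0)) cre0.
by rewrite scale1r.
Qed.

(** At z = 0 the exponential is 1, so that Delta(0) v is - L of the constant
    history v. *)
Lemma right_null (q : 'cV[R]_n) :
  charmx h zeta 0 *m map_mx (real_complex R) q = 0 -> L (cst_hist h q) = 0.
Proof.
rewrite (charmxE h_gt0 zeta_L) cmx_mul_map => /cmx_eq0_re/=.
rewrite raddf0 sub0r mulNmx => /eqP; rewrite oppr_eq0 => /eqP.
by rewrite (Lmx_mul _ _ (@cre_continuous 0)) dhist_cre0.
Qed.

Lemma left_null (p : 'rV[R]_n) (v : 'cV[R]_n) :
  map_mx (real_complex R) p *m charmx h zeta 0 = 0 ->
  p *m L (cst_hist h v) = 0.
Proof.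
rewrite (charmxE h_gt0 zeta_L) map_mul_cmx => /cmx_eq0_re/=.
rewrite raddf0 sub0r mulmxN => /eqP; rewrite oppr_eq0 => /eqP p0.
by rewrite -dhist_cre0 -(Lmx_mul _ _ (@cre_continuous 0)) mulmxA p0 mul0mx.
Qed.

(** Delta'(0) q is q + L psi, where psi(theta) = - theta q. *)
Lemma normalization (p : 'rV[R]_n) (q : 'cV[R]_n) :
  map_mx (real_complex R) p *m derive1 (charmx h zeta) 0
    *m map_mx (real_complex R) q = 1%:M ->
  p *m q + p *m L (dhist id q) = 1%:M.
Proof.
rewrite charmx_derive1 -!map_mxM -(map_mx1 (real_complex R)).
move=> /map_mx_inj <-; rewrite -(Lmx_mul _ _ (fun x => @cvg_id _ (nbhs x))).
by rewrite mulmxDr mulmx1 mulmxDl mulmxA.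
Qed.

End CharacteristicDerivative.

(** * Orbits on the center manifold *)

Lemma normal_form_growth (R : realType) (xi rho b' C' : R) :
  `|xi| <= 1 -> `|rho| <= C' * `|xi| ^+ 3 ->
  `|b' * xi ^+ 2 + rho| <= (`|b'| + `|C'| + 1) * `|xi| ^+ 2.
Proof.
move=> x1 rC; rewrite (le_trans (ler_normD _ _))// normrM normrX.
have : `|rho| <= `|C'| * `|xi| ^+ 2.
  rewrite (le_trans rC)// (le_trans (ler_wpM2r _ (ler_norm C')))// ?exprn_ge0//.
  by rewrite ler_wpM2l// ler_wiXn2l.
have : 0 <= `|xi| ^+ 2 by rewrite exprn_ge0.
by move=> x0 H1; rewrite 2!mulrDl mul1r; lra.
Qed.

(** Here b' xi^2 - b' e^2 = b' (xi - e) (xi + e) is of third order in e. *)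
Lemma normal_form_increment (R : realType) (xi rho e b' C' D : R) : 0 < e -> `|xi| <= 2 * e ->
  `|xi - e| <= D * e ^+ 2 -> `|rho| <= C' * `|xi| ^+ 3 ->
  `|b' * xi ^+ 2 + rho - b' * e ^+ 2| <= (3 * `|b'| * D + 8 * `|C'|) * e ^+ 3.
Proof.
move=> e0 xe xD rC.
have -> : b' * xi ^+ 2 + rho - b' * e ^+ 2 = b' * ((xi - e) * (xi + e)) + rho by ring.
apply: le_trans (ler_normD _ _) _; rewrite [leRHS]mulrDl; apply: lerD.
  rewrite !normrM.
  have xe3 : `|xi + e| <= 3 * e.
    by rewrite (le_trans (ler_normD _ _))// (gtr0_norm e0); lra.
  have -> : 3 * `|b'| * D * e ^+ 3 = `|b'| * (D * e ^+ 2 * (3 * e)) by ring.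
  by rewrite ler_wpM2l// ler_pM.
rewrite (le_trans rC)// (le_trans (ler_wpM2r _ (ler_norm C')))// ?exprn_ge0//.
have -> : 8 * `|C'| * e ^+ 3 = `|C'| * (2 * e) ^+ 3 by ring.
by rewrite ler_wpM2l// lerXn2r ?nnegrE// mulr_ge0// ltW.
Qed.

Section CenterManifoldFlow.
Context {R : realType} {h : R} {n : nat}.
Local Notation X := (hist h n).
Variables (F : R * X -> 'cV[R]_n) (xbar q : 'cV[R]_n) (W : set (R * X)).
Variables (delta : R) (H : R -> R -> X) (H2 : R -> X) (b T : R).
Local Notation xb := (cst_hist h xbar).
Local Notation phi := (cst_hist h q).
Hypothesis h_gt0 : 0 < h.
Hypothesis dF : forall z, differentiable F z.
Hypothesis ddF : forall z, differentiable (fderiv F) z.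
Hypothesis cddF : continuous (fderiv (fderiv F)).
Hypothesis F0 : forall t, F (t, xb) = 0.
Hypothesis W_inv : locally_positively_invariant F xbar W.
Hypothesis delta_gt0 : 0 < delta.
Hypothesis H_par : parametrizes xbar W delta H.
Hypothesis H_exp : expansion xbar phi H2 H.
Hypothesis b_nf : normal_form F T delta H b.

Lemma H_zero (t : R) : H t 0 = xb.
Proof.
have [C] := H_exp; move=> /nbhs_singleton/(_ t).
rewrite scale0r addr0 expr0n mulr0 scale0r addr0 normr0 expr0n mulr0 normr_le0.
by rewrite subr_eq0 => /eqP.
Qed.

(** The solution that starts at H(s, e) stays in W by local invariance, and
    therefore has a coordinate xi, to which the normal form applies.  As long as
    |xi| < 2 e, the right-hand side of the normal form is O(e^2), so over a
    bounded time xi moves by O(e^2) < e: by the barrier principle the bound 2 e is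
    never reached.  A second integration gives the expansion of xi to third
    order. *)
Lemma center_orbit (s0 : R) : exists tau C e0 : R,
  [/\ 0 < tau, 0 < C, 0 < e0 & forall s e, `|s - s0| <= tau -> 0 < e < e0 ->
    exists x xi, [/\ continuous x,
      forall t : R, s < t < s + tau -> is_derive t 1 x (F (t, segment h x t)),
      forall t, s <= t <= s + tau -> segment h x t = H t (xi t) &
      forall t, s <= t <= s + tau -> [/\ `|xi t| <= 2 * e, `|xi t - e| <= C * e ^+ 2
        & `|xi t - e - b * e ^+ 2 * (t - s)| <= C * e ^+ 3]]].
Proof.
have [r1 [K [r10 K0 FK]]] := lipschitz_near dF ddF s0 xb.
have [epsW epsW0 Winv] := W_inv.
have [epsH epsH0 Honto] := par_onto H_par.
have [r [r0 rr1 rW rH]] : exists r : R, [/\ 0 < r, r <= r1, r < epsW & r < epsH].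
  exists (Num.min r1 (Num.min (epsW / 2) (epsH / 2))).
  rewrite !lt_min r10 !divr_gt0//= ge_min lexx; split => //.
    by rewrite gt_min gt_min ltr_pdivrMr// ltr_pMr// ltr1n ?orbT.
  by rewrite gt_min gt_min [epsH / 2 < _]ltr_pdivrMr// ltr_pMr// ltr1n ?orbT.
have cF : continuous F by move=> z; exact: differentiable_continuous.
have FK' t psi1 psi2 : `|t - s0| <= r -> `|psi1 - xb| <= r -> `|psi2 - xb| <= r ->
    `|F (t, psi1) - F (t, psi2)| <= K * `|psi1 - psi2|.
  move=> tr p1 p2.
  exact: (FK _ _ _ (le_trans tr rr1) (le_trans p1 rr1) (le_trans p2 rr1)).
have FB t psi : `|t - s0| <= r -> `|psi - xb| <= r -> `|F (t, psi)| <= K * r.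
  move=> tr pr; have xr0 : `|xb - xb| <= r by rewrite subrr normr0 ltW.
  have := FK' t psi xb tr pr xr0; rewrite F0 subr0 => H1; apply: le_trans H1 _.
  exact: ler_wpM2l (ltW K0) _ _ pr.
have [tau1 tau10 sol] := local_solution (ltW h_gt0) r0 K0 (mulr_gt0 K0 r0) cF FB FK'.
have cH : {for (s0, 0), continuous (fun u : R * R => H u.1 u.2)}.
  by apply: (par_cts H_par); rewrite inE /= normr0.
have r20 : 0 < r / 2 by rewrite divr_gt0.
have /continuous_normP/(_ _ r20)[d1 d10 Hd1] := cH.
have [rho [_ [Cr /near_normP[dr dr0 rhoC]] nf]] := b_nf.
pose tau := Num.min tau1 (d1 / 2).
have tau0 : 0 < tau by rewrite lt_min tau10 divr_gt0.
have tau1' : tau <= tau1 by rewrite ge_min lexx.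
have taud1 : tau < d1.
  by rewrite gt_min ltr_pdivrMr// ltr_pMr// ltr1n orbT.
pose K1 := `|b| + `|Cr| + 1.
have K10 : 0 < K1 by rewrite ltr_wpDl.
(* |xi'| <= K1 (2 e)^2 while |xi| < 2 e, so xi moves by at most D e^2 *)
pose D := 4 * K1 * tau.
have D0 : 0 < D by rewrite !mulr_gt0.
pose E := (3 * `|b| * D + 8 * `|Cr|) * tau.
have E0 : 0 <= E.
  apply: mulr_ge0 (ltW tau0); apply: addr_ge0; last by rewrite mulr_ge0.
  by apply: mulr_ge0 (ltW D0); rewrite mulr_ge0.
have [e0 [e00 e0d1 e0dl e0dr [e01 e0D]]] : exists e0 : R,
    [/\ 0 < e0, e0 <= d1, e0 <= delta, 2 * e0 <= dr & 2 * e0 <= 1 /\ e0 * D <= 1].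
  exists (Num.min d1 (Num.min delta (Num.min (dr / 2) (Num.min 2^-1 D^-1)))).
  set m := Num.min _ _.
  have m1 : m <= d1 by rewrite ge_min lexx.
  have m2 : m <= delta by rewrite !ge_min lexx ?orbT.
  have m3 : m <= dr / 2 by rewrite !ge_min lexx ?orbT.
  have m4 : m <= 2^-1 by rewrite !ge_min lexx ?orbT.
  have m5 : m <= D^-1 by rewrite !ge_min lexx ?orbT.
  split => //; first by rewrite !lt_min d10 delta_gt0 divr_gt0// !invr_gt0 D0 ltr0n.
    by rewrite mulrC -ler_pdivlMr.
  by rewrite mulrC -ler_pdivlMr// div1r -ler_pdivlMr// div1r.
exists tau, (D + E), e0; split => //; first by rewrite ltr_wpDr.
move=> s e ss0 /andP[e_gt0 ee0].
have ne : `|e| = e by rewrite gtr0_norm.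
have He : `|H s e - xb| <= r / 2.
  have := Hd1 (s, e); rewrite /= H_zero; apply; rewrite prod_normE/= gt_max.
  by rewrite subr0 ne (le_lt_trans ss0 taud1)/= (lt_le_trans ee0).
have [x [cx xs xr dx]] := sol s (H s e) (le_trans ss0 tau1') He.
have elt : `|e| < delta by rewrite ne (lt_le_trans ee0).
have sW : W (s, segment h x s) by rewrite xs; exact: par_in H_par _ _ elt.
have xsol t1 : s < t1 <= s + tau -> solution F s t1 x.
  move=> /andP[st1 t1s]; split; first exact: continuous_subspaceT.
  move=> t /andP[st tt1]; apply: dx; rewrite st/=.
  by rewrite (lt_le_trans tt1)// (le_trans t1s)// lerD2l.
have xr' t : s <= t <= s + tau -> `|segment h x t - xb| <= r.
  by move=> /andP[st ts]; apply: xr; rewrite st (le_trans ts)// lerD2l.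
have tW t : s <= t <= s + tau -> W (t, segment h x t).
  move=> /andP[st ts]; have [<-//|tns] := eqVneq s t.
  have {}st : s < t by rewrite lt_def eq_sym tns.
  apply: (Winv s t x st (xsol t _) sW); first by rewrite st.
  move=> t' /andP[st' t't]; apply: le_lt_trans rW; apply: xr'.
  by rewrite st' (le_trans t't).
have /choice[xi xiP] : forall t, exists xi, s <= t <= s + tau ->
    `|xi| < delta /\ segment h x t = H t xi.
  move=> t; case: (boolP (s <= t <= s + tau)) => [st|_]; last by exists 0.
  have [xi xid xiH] := Honto t _ (tW t st) (le_lt_trans (xr' t st) rH).
  by exists xi.
have stau : s < s + tau by rewrite ltrDl.
have ss : s <= s <= s + tau by rewrite lexx ltW.
have xis : xi s = e.
  have [xid xiH] := xiP s ss.
  exact: (par_inj H_par xid elt (etrans (esym xiH) xs)).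
have stt : s < s + tau <= s + tau by rewrite stau lexx.
have [cxi dxi] := nf s (s + tau) x xi stau (xsol _ stt) xiP.
have rhoP t : `|xi t| < 2 * e -> `|rho t (xi t)| <= Cr * `|xi t| ^+ 3.
  by move=> xe; apply: rhoC; rewrite subr0 (lt_le_trans xe)// (le_trans _ e0dr)// ler_pM2l// ltW.
have le_2e1 : 2 * e <= 1 by rewrite (le_trans _ e01)// ler_pM2l// ltW.
have cxi' t : s <= t <= s + tau -> {within `[s, t], continuous xi}.
  move=> /andP[_ ts]; apply: continuous_subspaceW cxi.
  by move=> u; rewrite /= !in_itv/= => /andP[-> /le_trans->].
have growth u : `|xi u| < 2 * e -> `|b * xi u ^+ 2 + rho u (xi u)| <= K1 * (2 * e) ^+ 2.
  move=> xe; apply: le_trans (normal_form_growth b _ (rhoP u xe)) _.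
    by rewrite (le_trans (ltW xe)).
  have e2 : 0 <= 2 * e by rewrite mulr_ge0// ltW.
  by rewrite ler_pM2l// lerXn2r ?nnegrE//; exact: ltW.
have D_incr t : s <= t <= s + tau -> (forall u, s <= u < t -> `|xi u| < 2 * e) ->
    `|xi t - e| <= D * e ^+ 2.
  move=> /andP[st ts] xu.
  have := @mean_value_bound R xi (fun u => b * xi u ^+ 2 + rho u (xi u)) s t 0
    (K1 * (2 * e) ^+ 2) st; rewrite mul0r subr0 xis => mv.
  apply: le_trans (mv _ _ _) _.
  - by move=> u /andP[su ut]; apply: dxi; rewrite su (lt_le_trans ut).
  - by apply: cxi'; rewrite st.
  - by move=> u /andP[su ut]; rewrite subr0; apply: growth => //; apply: xu; rewrite ltW.
  have -> : D * e ^+ 2 = K1 * (2 * e) ^+ 2 * tau by rewrite /D; ring.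
  apply: ler_wpM2l; last by rewrite lerBlDl.
  by rewrite mulr_ge0 ?sqr_ge0// ltW.
have xi2e t : s <= t <= s + tau -> `|xi t| < 2 * e.
  move: t; apply: (@continuous_barrier R (fun t => `|xi t|)).
    by move=> t; apply: cvg_norm; exact: cxi.
  move=> t st xu; have Dt := D_incr t st xu.
  rewrite -(subrK e (xi t)) (le_lt_trans (ler_normD _ _))// ne mulr_natl mulr2n ltrD2r.
  apply: le_lt_trans Dt _; rewrite expr2 mulrA gtr_pMl// mulrC.
  by rewrite (lt_le_trans _ e0D)// ltr_pM2r.
exists x, xi; split => //.
- by move=> t /andP[st ts]; apply: dx; rewrite st (lt_le_trans ts)// lerD2l.
- by move=> t /xiP[].
move=> t st; have /andP[st1 st2] := st.
have Du u : s <= u <= t -> `|xi u - e| <= D * e ^+ 2.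
  move=> /andP[su ut]; apply: D_incr; first by rewrite su (le_trans ut).
  by move=> v /andP[sv vu]; apply: xi2e; rewrite sv (le_trans (ltW vu))// (le_trans ut).
split; first exact/ltW/xi2e.
  rewrite (le_trans (Du t _)) ?st1 ?lexx// ler_wpM2r ?sqr_ge0// lerDl//.
have := @mean_value_bound R xi (fun u => b * xi u ^+ 2 + rho u (xi u)) s t
  (b * e ^+ 2) ((3 * `|b| * D + 8 * `|Cr|) * e ^+ 3) st1; rewrite xis => mv.
apply: le_trans (mv _ _ _) _.
- by move=> u /andP[su ut]; apply: dxi; rewrite su (lt_le_trans ut).
- exact: cxi'.
- move=> u /andP[su ut].
  have uu : s <= u <= s + tau by rewrite ltW//= (le_trans (ltW ut)).
  apply: normal_form_increment => //; first exact/ltW/xi2e.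
    by apply: Du; rewrite !ltW.
  by apply: rhoP; exact: xi2e.
have e30 : 0 <= e ^+ 3 by rewrite exprn_ge0 ?ltW.
apply: (@le_trans _ _ (E * e ^+ 3)); last by rewrite ler_wpM2r// lerDr ltW.
rewrite /E [leRHS]mulrAC; apply: ler_wpM2l; last by rewrite lerBlDl.
apply: mulr_ge0 => //; apply: addr_ge0; last by rewrite mulr_ge0.
by apply: mulr_ge0 (ltW D0); rewrite mulr_ge0.
Qed.

(** For fixed xi <> 0, the second-order quotient
    2 (H(t, xi) - xbar - xi phi) / xi^2 is continuous in t, and it converges to
    H2(t) uniformly in t as xi tends to 0. *)
Lemma H2_continuous : continuous H2.
Proof.
move=> t0; have [C /near_normP[d d0 HC]] := H_exp.
apply/continuous_normP => eps eps0.
pose K := 2 * (1 + 2 * `|C|).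
have K0 : 0 < K by rewrite mulr_gt0// ltr_pwDl// mulr_ge0.
have [e [e0 ed edl eK]] : exists e : R, [/\ 0 < e, e < d, e < delta & K * e <= eps].
  exists (Num.min (d / 2) (Num.min (delta / 2) (eps / K))).
  rewrite !lt_min !divr_gt0//=; split => //.
  - by rewrite gt_min ltr_pdivrMr// ltr_pMr// ltr1n.
  - by rewrite gt_min gt_min [delta / 2 < _]ltr_pdivrMr// ltr_pMr// ltr1n orbT.
  - by rewrite mulrC -ler_pdivlMr// !ge_min lexx !orbT.
have ne : `|e| = e by rewrite gtr0_norm.
have cH : {for (t0, e), continuous (fun u : R * R => H u.1 u.2)}.
  by apply: (par_cts H_par); rewrite inE /= ne.
have e30 : 0 < e ^+ 3 by rewrite exprn_gt0.
have /continuous_normP/(_ _ e30)[d1 d10 Hd1] := cH.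
exists d1 => // t tt0.
have Hte s : `|H s e - (xb + e *: phi + (2^-1 * e ^+ 2) *: H2 s)| <= `|C| * e ^+ 3.
  have ed' : `|e - 0| < d by rewrite subr0 ne.
  apply: le_trans (HC e ed' s) _; rewrite ne.
  by apply: ler_wpM2r (ltW e30) _ _ (ler_norm C).
have c0 : 0 <= 2^-1 * e ^+ 2 by rewrite mulr_ge0 ?invr_ge0// sqr_ge0.
have := quadratic_coef_diff c0 (Hte t) (Hte t0).
have := Hd1 (t, e); rewrite prod_normE/= subrr normr0 gt_max tt0 d10 => /(_ isT) H1 H3.
have {H1}H3 : 2^-1 * e ^+ 2 * `|H2 t - H2 t0| <= e ^+ 3 + 2 * (`|C| * e ^+ 3).
  by apply: le_trans H3 _; rewrite lerD2r.
apply: le_trans eK; rewrite -(ler_pM2l (_ : 0 < 2^-1 * e ^+ 2)); last first.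
  by rewrite mulr_gt0 ?invr_gt0// exprn_gt0.
apply: le_trans H3 _; rewrite le_eqVlt; apply/orP; left; apply/eqP.
by rewrite /K; field.
Qed.

(** The second-order part, in the small parameter e, of the orbit that leaves
    H(s, e) at time s. *)
Definition orbit2 (s t : R) : X := (b * (t - s)) *: phi + 2^-1 *: H2 t.

(** Insert the expansion of xi into that of H.  The constants do not depend on
    e nor on s, which allows e to tend to 0 afterwards. *)
Lemma orbit_expansion (s0 : R) : exists tau C e0 : R,
  [/\ 0 < tau, 0 < C, 0 < e0 & forall s e, `|s - s0| <= tau -> 0 < e < e0 ->
    exists x, [/\ continuous x,
      forall t : R, s < t < s + tau -> is_derive t 1 x (F (t, segment h x t)) &
      forall t, s <= t <= s + tau ->
        `|segment h x t - xb - e *: phi - e ^+ 2 *: orbit2 s t| <= C * e ^+ 3]].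
Proof.
have [tau1 [C1 [e1 [tau10 C10 e10 orb]]]] :=
  center_orbit s0.
have [C /near_normP[d d0 HC]] := H_exp.
have /continuous_normP/(_ _ ltr01)[d2 d20 Hd2] := @H2_continuous s0.
pose tau := Num.min tau1 (d2 / 4).
have tau0 : 0 < tau by rewrite lt_min tau10 divr_gt0.
have tau1' : tau <= tau1 by rewrite ge_min lexx.
have taud2 : 2 * tau < d2.
  have : tau <= d2 / 4 by rewrite ge_min lexx orbT.
  by move=> td; lra.
pose M := `|H2 s0| + 1.
have HM t : `|t - s0| < d2 -> `|H2 t| <= M.
  move=> /Hd2 Ht; rewrite -[H2 t](subrK (H2 s0)) addrC.
  by apply: le_trans (ler_normD _ _) _; rewrite lerD2l.
have M0 : 0 <= M by rewrite addr_ge0.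
pose D := 8 * `|C| + C1 * `|phi| + 3 / 2 * C1 * M.
have D0 : 0 <= D.
  apply: addr_ge0; first by apply: addr_ge0; apply: mulr_ge0 => //; exact: ltW.
  by apply: mulr_ge0 M0; apply: mulr_ge0 (ltW C10); rewrite divr_ge0.
pose e0 := Num.min e1 (d / 2).
exists tau, (D + 1), e0; split => //; first by rewrite ltr_wpDl.
  by rewrite lt_min e10 divr_gt0.
move=> s e ss0 /andP[e_gt0 ee0].
have ee1 : 0 < e < e1 by rewrite e_gt0 (lt_le_trans ee0)// ge_min lexx.
have ed : 2 * e < d.
  have : e < d / 2 by rewrite (lt_le_trans ee0)// ge_min lexx orbT.
  by move=> ed; lra.
have [x [xi [cx dx xH xiP]]] := orb s e (le_trans ss0 tau1') ee1.
have tau_in t : t <= s + tau -> t <= s + tau1.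
  by move=> /le_trans; apply; rewrite lerD2l.
exists x; split => //.
  move=> t /andP[st ts]; apply: dx; rewrite st (lt_le_trans ts)//.
  by rewrite lerD2l.
move=> t /andP[st ts].
have tt : s <= t <= s + tau1 by rewrite st tau_in.
have [x1 x2 x3] := xiP t tt.
have td2 : `|t - s0| < d2.
  apply: le_lt_trans taud2; move: ss0; rewrite !ler_norml => /andP[h1 h2].
  by apply/andP; split; lra.
have e30 : 0 <= e ^+ 3 by rewrite exprn_ge0// ltW.
apply: (@le_trans _ _ (D * e ^+ 3)); last by rewrite ler_wpM2r// lerDl.
have x3' : `|xi t - e - b * (t - s) * e ^+ 2| <= C1 * e ^+ 3.
  by rewrite [b * _ * _]mulrAC.
have xd : `|xi t - 0| < d by rewrite subr0 (le_lt_trans x1).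
have := HC (xi t) xd t; rewrite -(xH t tt) => yP.
exact: (quadratic_recenter e_gt0 (ltW C10) yP x1 x2 x3' (HM t td2)).
Qed.

(** Both sides are the coefficient of e^2 of the same number x(t + theta). *)
Lemma orbit2_shift (s0 : R) : exists2 tau : R, 0 < tau &
  forall s t t' (th th' : set_type `[- h, 0]%classic), `|s - s0| <= tau ->
    s <= t <= s + tau -> s <= t' <= s + tau ->
    t + \val th = t' + \val th' -> orbit2 s t th = orbit2 s t' th'.
Proof.
have [tau [C [e0 [tau0 C0 e00 orb]]]] := orbit_expansion s0.
exists tau => // s t t' th th' ss0 st st' tt'.
apply/eqP; rewrite -subr_eq0 -normr_le0.
apply: (@le_limit0 _ _ 0 (2 * C) e0) => [//||e e_in]; first by rewrite mulr_ge0// ltW.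
have [x [cx _ xP]] := orb s e ss0 e_in; have /andP[e_gt0 _] := e_in.
have P u (uh : set_type `[- h, 0]%classic) : s <= u <= s + tau ->
    `|x (u + \val uh) - (xbar + e *: q + e ^+ 2 *: orbit2 s u uh)| <= C * e ^+ 3.
  move=> /xP; apply: le_trans; rewrite -(segmentE u uh cx) !opprD !addrA.
  exact: (hist_norm_ub (segment h x u - xb - e *: phi - e ^+ 2 *: orbit2 s u)).
have Pt := P t th st; have Pt' := P t' th' st'; rewrite -tt' in Pt'.
have := quadratic_coef_diff (sqr_ge0 e) Pt Pt'.
rewrite subrr normr0 !add0r => Pd.
have e2 : 0 < e ^+ 2 by rewrite exprn_gt0.
rewrite -(ler_pM2l e2); apply: le_trans Pd _.
by rewrite le_eqVlt; apply/orP; left; apply/eqP; ring.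
Qed.

Let z0 := clamp (ltW h_gt0) 0.

Lemma val_z0 : \val z0 = 0.
Proof. by rewrite /z0/= minxx; apply: max_idPr; rewrite oppr_le0 ltW. Qed.

(** By [orbit2_shift], H2(c - theta)(theta) - 2 b theta q is locally constant in
    theta for each c; it is constant on [-h, 0], and theta = 0 gives its value. *)
Lemma H2_transport (t : R) (th : set_type `[- h, 0]%classic) :
  H2 t th = (2 * b * \val th) *: q + H2 (t + \val th) z0.
Proof.
have /andP[th1 th2] := delays_itv th.
pose c := t + \val th.
pose g u := H2 (c - u) (clamp (ltW h_gt0) u) - (2 * b * u) *: q.
suff : g (\val th) = g 0.
  rewrite /g /c addrK subr0 mulr0 scale0r subr0 (clamp_id _ (erefl _)) => <-.
  by rewrite addrC subrK.
apply: locally_constant_itv => // u _.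
have [tau tau0 tauP] := orbit2_shift (c - u).
exists (tau / 2); first by rewrite divr_gt0.
move=> y z /andP[y1 y2] /andP[z1 z2]; rewrite !ltr_norml => /andP[y3 y4] /andP[z3 z4].
have vc v : - h <= v -> v <= 0 -> \val (clamp (ltW h_gt0) v) = v.
  by move=> v1 v2; rewrite /= (min_idPl v2) (max_idPr v1).
have vy := vc y (le_trans th1 y1) y2; have vz := vc z (le_trans th1 z1) z2.
pose s := c - u - tau / 2.
have E : orbit2 s (c - y) (clamp (ltW h_gt0) y) = orbit2 s (c - z) (clamp (ltW h_gt0) z).
  apply: tauP.
  - by rewrite /s addrAC subrr add0r normrN ger0_norm ?divr_ge0// ?ltW//; lra.
  - by apply/andP; split; rewrite /s; lra.
  - by apply/andP; split; rewrite /s; lra.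
  - by rewrite vy vz !subrK.
have gE v : g v = 2 *: (orbit2 s (c - v) (clamp (ltW h_gt0) v) - (b * (c - s)) *: q).
  have -> : orbit2 s (c - v) (clamp (ltW h_gt0) v) =
    (b * (c - v - s)) *: q + 2^-1 *: H2 (c - v) (clamp (ltW h_gt0) v) by [].
  rewrite addrAC -scalerBl scalerDr !scalerA mulfV ?pnatr_eq0// scale1r.
  by rewrite /g addrC -scaleNr; congr (_ *: _ + _); ring.
by rewrite (gE y) (gE z) E.
Qed.

Variable L : blin X 'cV[R]_n.
Hypothesis L_def : forall t, restr (fderiv F (t, xb)) = L.
Hypothesis L_phi : L phi = 0.

Let A t := fderiv (fderiv F) (t, xb).
Let B t : 'cV[R]_n := A t (0, phi) (0, phi).
Let g t : 'cV[R]_n := 2^-1 *: (L (H2 t) + B t).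

Lemma second_derivative_continuous : continuous A.
Proof.
move=> t; apply: (@continuous_comp _ _ _ (fun t => (t, xb)) (fderiv (fderiv F))).
  apply: (@continuous_pair R R X id (fun=> xb)) => u; first exact: cvg_id.
  exact: cvg_cst.
exact: cddF.
Qed.

Lemma forcing_continuous : continuous B.
Proof.
move=> t; apply: (@continuous_comp _ _ _ (fun t => A t (0, phi)) (fun a => a (0, phi))).
  apply: (@continuous_comp _ _ _ A (fun a => a (0, phi))).
    exact: second_derivative_continuous.
  exact: blin_ev_continuous.
exact: blin_ev_continuous.
Qed.

Lemma velocity_continuous : continuous g.
Proof.
move=> t; apply: cvgZl_tmp; apply: cvgD; last exact: forcing_continuous.
apply: (@continuous_comp _ _ _ H2 L); last exact: blin_continuous.
exact: H2_continuous.
Qed.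

(** If eta = e phi + e^2 orbit2 + O(e^3), the Taylor polynomial of F at xbar
    has no term of order e, as L phi = 0, and its term of order e^2 is
    L orbit2 + B / 2 = g. *)
Lemma rhs_estimate (s t e eps1 K2 rho : R) (eta : X) :
  0 < e <= 1 -> 0 <= eps1 -> 0 <= rho -> 0 <= K2 ->
  `|F (t, xb + eta) - F (t, xb) - fderiv F (t, xb) (0, eta)
     - 2^-1 *: A t (0, eta) (0, eta)| <= eps1 * `|eta| ^+ 2 ->
  `|eta - e *: phi - e ^+ 2 *: orbit2 s t| <= rho * e ^+ 3 ->
  `|e ^+ 2 *: orbit2 s t| + rho * e ^+ 3 <= K2 * e ^+ 2 ->
  `|F (t, xb + eta) - e ^+ 2 *: g t|
    <= e ^+ 2 * (eps1 * (`|phi| + K2) ^+ 2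
      + e * (`|L| * rho + 2^-1 * `|A t| * K2 * (2 * `|phi| + K2))).
Proof.
move=> /andP[e0 e1] eps10 rho0 K20 taylor etaP K2P.
have e20 : 0 <= e ^+ 2 by exact: sqr_ge0.
have ne : `|e| = e by rewrite gtr0_norm.
pose r := eta - e *: phi - e ^+ 2 *: orbit2 s t.
pose z := e ^+ 2 *: orbit2 s t + r.
have etaE : eta = e *: phi + z.
  by rewrite /z /r addrA -[eta - _ - _]addrA -opprD addrC subrK.
have zK : `|z| <= K2 * e ^+ 2.
  by apply: le_trans (ler_normD _ _) _; apply: le_trans K2P; rewrite lerD2l.
have e2e : e ^+ 2 <= e by rewrite expr2 ler_piMl// ltW.
have zKe : `|z| <= K2 * e by apply: le_trans zK _; rewrite ler_wpM2l.
have etaK : `|eta| <= (`|phi| + K2) * e.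
  rewrite etaE; apply: le_trans (ler_normD _ _) _.
  by rewrite normrZ ne mulrDl [e * _]mulrC lerD2l.
have Leta : fderiv F (t, xb) (0, eta) = e ^+ 2 *: (2^-1 *: L (H2 t)) + L r.
  transitivity (L eta); first by rewrite -(L_def t).
  have LZ : L (orbit2 s t) = 2^-1 *: L (H2 t).
    by rewrite blinD blinZ L_phi scaler0 add0r blinZ.
  by rewrite etaE /z !blinD !blinZ L_phi scaler0 add0r LZ.
pose Q := A t (0, eta) (0, eta) - e ^+ 2 *: B t.
have QP : `|Q| <= `|A t| * (K2 * e ^+ 2) * (2 * e * `|phi| + K2 * e).
  have -> : Q = A t (e *: (0, phi) + (0, z)) (e *: (0, phi) + (0, z)) -
      e ^+ 2 *: A t (0, phi) (0, phi).
    have E : e *: ((0 : R), phi) + (0, z) = (0, eta).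
      by rewrite etaE; congr pair; rewrite /= ?scaler0 ?mulr0 addr0.
    by rewrite E.
  apply: le_trans (bilinear_perturb _ _ _ _) _; rewrite !norm_pair0 ne.
  apply: ler_pM => //.
  - by apply: addr_ge0 => //; apply: mulr_ge0 => //; rewrite mulr_ge0// ltW.
  - exact: ler_wpM2l.
  - by rewrite lerD2l.
pose S := F (t, xb + eta) - F (t, xb) - fderiv F (t, xb) (0, eta)
     - 2^-1 *: A t (0, eta) (0, eta).
have split_F : F (t, xb + eta) - e ^+ 2 *: g t = S + (L r + 2^-1 *: Q).
  rewrite /S /Q (F0 t) Leta subr0 scalerBr /g.
  rewrite [2^-1 *: (_ + B t)]scalerDr [e ^+ 2 *: (_ + _)]scalerDr.
  rewrite [2^-1 *: (e ^+ 2 *: _)]scalerA [e ^+ 2 *: (2^-1 *: B t)]scalerA.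
  rewrite [2^-1 * e ^+ 2]mulrC.
  move: (F _) (e ^+ 2 *: (2^-1 *: _)) (L r) (2^-1 *: A t _ _) (_ *: B t) => f u v w y.
  by rewrite !opprD !addrA (addrAC _ (- w) v) !subrK.
rewrite split_F; apply: le_trans (ler_normD _ _) _.
have -> : e ^+ 2 * (eps1 * (`|phi| + K2) ^+ 2 +
    e * (`|L| * rho + 2^-1 * `|A t| * K2 * (2 * `|phi| + K2))) =
  eps1 * ((`|phi| + K2) * e) ^+ 2 + (`|L| * (rho * e ^+ 3) +
    2^-1 * (`|A t| * (K2 * e ^+ 2) * (2 * e * `|phi| + K2 * e))) by ring.
apply: lerD.
  apply: le_trans taylor _; apply: ler_wpM2l => //.
  rewrite lerXn2r ?nnegrE//.
  by apply: mulr_ge0; [rewrite addr_ge0|exact: ltW].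
apply: le_trans (ler_normD _ _) _; apply: lerD.
  by apply: le_trans (blin_norm_ub _ _) _; rewrite ler_wpM2l.
by rewrite normrZ ger0_norm ?invr_ge0// ler_wpM2l// invr_ge0.
Qed.

(** The coefficient of e^2 in x' = F (t, x_t).  The bound for the increments
    of x(t) - e^2 t g(t0) is e^2 eps |t - t0| for all small e; dividing by e^2
    and letting e tend to 0 leaves the increments of the coefficient alone. *)
Lemma H2_velocity (t0 : R) :
  is_derive t0 1 (fun t => (b * t) *: q + 2^-1 *: H2 t z0) (g t0).
Proof.
have [tau [C [e0 [tau0 C0 e00 orb]]]] :=
  orbit_expansion t0.
apply/is_derive_normP => eps eps0.
have eps40 : 0 < eps / 4 by rewrite divr_gt0.
pose s := t0 - tau / 2.
have ss0 : `|s - t0| <= tau.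
  by rewrite /s addrAC subrr add0r normrN ger0_norm ?divr_ge0// ?ltW//; lra.
have /continuous_normP/(_ _ ltr01)[d1 d10 Hd1] := @second_derivative_continuous t0.
have /continuous_normP/(_ _ ltr01)[d2 d20 Hd2] := @H2_continuous t0.
have /continuous_normP/(_ _ eps40)[d3 d30 Hd3] := @velocity_continuous t0.
pose KA := `|A t0| + 1.
pose MZ := `|b| * tau * `|phi| + 2^-1 * (`|H2 t0| + 1).
have MZ0 : 0 <= MZ.
  by apply: addr_ge0; rewrite !mulr_ge0 ?invr_ge0// ?addr_ge0// ltW.
pose K2 := MZ + C.
have K20 : 0 <= K2 by rewrite addr_ge0// ltW.
pose K1 := `|phi| + K2.
have K10 : 0 <= K1 by rewrite addr_ge0.
pose K3 := `|L| * C + 2^-1 * KA * K2 * (2 * `|phi| + K2).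
have KA0 : 0 <= KA by rewrite addr_ge0.
have K30 : 0 <= K3.
  apply: addr_ge0; first by rewrite mulr_ge0// ltW.
  by apply: mulr_ge0; [rewrite !mulr_ge0 ?invr_ge0|rewrite addr_ge0// mulr_ge0].
pose eps1 := eps / 4 / (K1 ^+ 2 + 1).
have K11 : 0 < K1 ^+ 2 + 1 by rewrite ltr_wpDl// sqr_ge0.
have eps10 : 0 < eps1 by rewrite divr_gt0.
have [r r0 taylor] := taylor2_near dF ddF cddF t0 xb eps10.
pose d := Num.min (tau / 2) (Num.min r (Num.min d1 (Num.min d2 d3))).
have d0 : 0 < d by rewrite !lt_min divr_gt0//= r0 d10 d20.
have [dtau dr dd1 dd2 dd3] : [/\ d <= tau / 2, d <= r, d <= d1, d <= d2 & d <= d3].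
  by split; rewrite !ge_min lexx ?orbT.
exists d => // t tt0.
pose e1 := Num.min e0 (Num.min 1 (Num.min (r / (K1 + 1)) (eps / 4 / (K3 + 1)))).
have K1p : 0 < K1 + 1 by rewrite ltr_wpDl.
have K3p : 0 < K3 + 1 by rewrite ltr_wpDl.
have e10 : 0 < e1 by rewrite !lt_min e00 ltr01 !divr_gt0.
pose P u := (b * u) *: q + 2^-1 *: H2 u z0.
apply: (@le_limit0 _ _ _ (2 * C) e1) => [//||e /andP[e_gt0 ee1]].
  by rewrite mulr_ge0// ltW.
have [ee0 e_le1 er e3] : [/\ e < e0, e <= 1, e * (K1 + 1) <= r & e * (K3 + 1) <= eps / 4].
  split.
  - by rewrite (lt_le_trans ee1)// ge_min lexx.
  - by rewrite (le_trans (ltW ee1))// !ge_min lexx ?orbT.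
  - by rewrite -ler_pdivlMr// (le_trans (ltW ee1))// !ge_min lexx ?orbT.
  - by rewrite -ler_pdivlMr// (le_trans (ltW ee1))// !ge_min lexx ?orbT.
have e_in : 0 < e < e0 by rewrite e_gt0.
have [x [cx dx xP]] := orb s e ss0 e_in.
have win u : `|u - t0| < d -> s < u < s + tau.
  move=> /lt_le_trans/(_ dtau); rewrite ltr_norml /s => /andP[u1 u2].
  by apply/andP; split; lra.
have win' u : `|u - t0| < d -> s <= u <= s + tau.
  by move=> /win/andP[u1 u2]; rewrite !ltW.
have e20 : 0 < e ^+ 2 by rewrite exprn_gt0.
(* the right-hand side along the orbit is e^2 g(t0) up to a small error *)
have rhs u : `|u - t0| < d ->
    `|F (u, segment h x u) - e ^+ 2 *: g t0| <= e ^+ 2 * eps.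
  move=> ud; have su := win' u ud; have etaP := xP u su.
  pose eta := segment h x u - xb.
  have xE : segment h x u = xb + eta by rewrite /eta addrC subrK.
  have H2u : `|H2 u| <= `|H2 t0| + 1.
    rewrite -[H2 u](subrK (H2 t0)) addrC.
    apply: le_trans (ler_normD _ _) _; rewrite lerD2l.
    exact: Hd2 (lt_le_trans ud dd2).
  have ZM : `|orbit2 s u| <= MZ.
    apply: le_trans (ler_normD _ _) _; apply: lerD; last first.
      by rewrite normrZ ger0_norm ?invr_ge0// ler_wpM2l// invr_ge0.
    rewrite normrZ normrM; apply: ler_wpM2r => //; apply: ler_wpM2l => //.
    have /andP[su1 su2] := su.
    by rewrite ger0_norm ?subr_ge0// lerBlDl.
  have ZK2 : `|e ^+ 2 *: orbit2 s u| + C * e ^+ 3 <= K2 * e ^+ 2.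
    rewrite normrZ gtr0_norm// [leRHS]mulrDl; apply: lerD.
      by rewrite mulrC ler_wpM2r// ltW.
    by rewrite ler_pM2l// ler_wiXn2l// ltW.
  have etaK : `|eta| <= K1 * e.
    have -> : eta = e *: phi + (e ^+ 2 *: orbit2 s u +
        (eta - e *: phi - e ^+ 2 *: orbit2 s u)).
      by rewrite addrA -[eta - _ - _]addrA -opprD addrC subrK.
    apply: le_trans (ler_normD _ _) _; rewrite /K1 mulrDl; apply: lerD.
      by rewrite normrZ gtr0_norm// mulrC.
    apply: le_trans (ler_normD _ _) _.
    apply: (@le_trans _ _ (`|e ^+ 2 *: orbit2 s u| + C * e ^+ 3)).
      by rewrite lerD2l; exact: etaP.
    apply: le_trans ZK2 _; apply: ler_wpM2l => //.
    by rewrite expr2 ler_piMl// ltW.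
  have etar : `|eta| <= r.
    apply: le_trans etaK _; apply: le_trans er; rewrite mulrC.
    by rewrite ler_pM2l// lerDl.
  have ur : `|u - t0| <= r by rewrite ltW// (lt_le_trans ud).
  have e01 : 0 < e <= 1 by rewrite e_gt0.
  have := rhs_estimate e01 (ltW eps10) (ltW C0) K20 (taylor u eta ur etar) etaP ZK2.
  rewrite -/eta -xE => rhsP.
  rewrite -(subrKA (e ^+ 2 *: g u)).
  apply: le_trans (ler_normD _ _) _.
  apply: (@le_trans _ _ (e ^+ 2 * (eps / 4 + eps / 4) + e ^+ 2 * (eps / 4))); last first.
    by rewrite -mulrDr ler_pM2l//; lra.
  apply: lerD; last first.
    rewrite -scalerBr normrZ gtr0_norm// ler_pM2l//.
    exact: Hd3 (lt_le_trans ud dd3).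
  apply: le_trans rhsP _; rewrite ler_pM2l//; apply: lerD.
    rewrite -/K1 /eps1 mulrAC ler_pdivrMr// ler_pM2l//.
    by rewrite lerDl.
  apply: le_trans e3; rewrite ler_pM2l//.
  apply: (@le_trans _ _ K3); last by rewrite lerDl.
  rewrite lerD2l; apply: ler_wpM2r; first by rewrite addr_ge0// mulr_ge0.
  apply: ler_wpM2r => //; rewrite ler_pM2l ?invr_gt0//.
  rewrite -[A u](subrK (A t0)) addrC.
  apply: le_trans (ler_normD _ _) _; rewrite lerD2l.
  exact: Hd1 (lt_le_trans ud dd1).
pose f u := x u - u *: (e ^+ 2 *: g t0).
have df (u : R) : t0 - d < u < t0 + d ->
    is_derive u 1 f (F (u, segment h x u) - e ^+ 2 *: g t0).
  rewrite -ltr_distl => /win su.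
  exact: is_deriveB (dx u su) (is_derive_scalel _ u).
have t0d : `|t0 - t0| < d by rewrite subrr normr0.
have ft : `|f t - f t0| <= e ^+ 2 * eps * `|t - t0|.
  apply: (mean_value_col_sym _ df).
  - by rewrite mulr_ge0// ltW.
  - by move=> u; rewrite -ltr_distl => /rhs.
  - by rewrite -ltr_distl.
  - by rewrite -ltr_distl.
have near_orbit u : `|u - t0| < d ->
    `|x u - (xbar + e *: q + e ^+ 2 *: orbit2 s u z0)| <= C * e ^+ 3.
  move=> /win'/xP; apply: le_trans; rewrite !opprD !addrA.
  have -> : x u = segment h x u z0 by rewrite (segmentE u z0 cx) val_z0 addr0.
  exact: (hist_norm_ub (segment h x u - xb - e *: phi - e ^+ 2 *: orbit2 s u)).
(* the tangent line to x at t0 is compared with x as if it were an orbit *)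
have near_t0 : `|x t0 + (t - t0) *: (e ^+ 2 *: g t0) -
    (xbar + e *: q + e ^+ 2 *: (orbit2 s t0 z0 + (t - t0) *: g t0))| <= C * e ^+ 3.
  rewrite scalerDr scalerA [(t - t0) * _]mulrC -scalerA addrA opprD addrACA subrr addr0.
  exact: near_orbit.
have := quadratic_coef_diff (ltW e20) (near_orbit t tt0) near_t0.
have -> : orbit2 s t z0 - (orbit2 s t0 z0 + (t - t0) *: g t0) =
    P t - P t0 - (t - t0) *: g t0.
  rewrite opprD addrA; congr (_ - _).
  have orbit2E u : orbit2 s u z0 = P u - (b * s) *: q.
    have -> : orbit2 s u z0 = (b * (u - s)) *: q + 2^-1 *: H2 u z0 by [].
    by rewrite mulrBr scalerBl addrAC.
  by rewrite !orbit2E opprD opprK addrACA addNr addr0.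
have -> : x t - (x t0 + (t - t0) *: (e ^+ 2 *: g t0)) = f t - f t0.
  by rewrite /f subrACA scalerBl opprD addrA.
move=> Pe; rewrite -(ler_pM2l e20); apply: le_trans Pe _.
apply: (@le_trans _ _ (e ^+ 2 * eps * `|t - t0| + 2 * (C * e ^+ 3))).
  by rewrite lerD2r.
by rewrite le_eqVlt; apply/orP; left; apply/eqP; ring.
Qed.

Hypothesis H2_periodic : forall t, H2 (t + T) = H2 t.

(** The primitive is M(t)(theta) = 2 b t theta q + U(t + theta), where U is a
    primitive of H2(t)(0).  Since [dhist id q] is the history - theta q, the
    increment of M over a period is 2 b T theta q plus the constant
    U(T) - U(0). *)
Lemma ex_mean_history : exists2 M : R -> X,
  (forall t : R, is_derive t 1 M (H2 t)) &
  exists v, M T - M 0 = (- (2 * b * T)) *: dhist id q + cst_hist h v.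
Proof.
pose u t := H2 t z0.
have cH2 : continuous H2 by exact: H2_continuous.
have cu : continuous u.
  move=> t; apply/continuous_normP => e e0.
  have /continuous_normP/(_ e e0)[d d0 dP] := cH2 t.
  exists d => // s /dP; apply: le_trans.
  exact: (hist_norm_ub (H2 s - H2 t)).
have [U UP] := ex_primitive_col cu.
have cU : continuous U by move=> t; exact: is_derive_continuous (UP t).
have cm t : continuous (fun t' : R => (2 * b * t) *: (t' *: q) + U (t + t')).
  move=> t'; apply: cvgD.
    by apply: cvgZl_tmp; apply: cvgZr_tmp; exact: cvg_id.
  apply: (@continuous_comp _ _ _ (fun t' => t + t') U); last exact: cU.
  by apply: cvgD; [exact: cvg_cst|exact: cvg_id].
have [M ME] : exists M : R -> X, forall t (th : set_type `[- h, 0]%classic),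
    M t th = (2 * b * t) *: (\val th *: q) + U (t + \val th).
  exists (fun t => segment h (fun t' => (2 * b * t) *: (t' *: q) + U (t + t')) 0).
  by move=> t th; rewrite (segmentE 0 th (cm t)) add0r.
exists M.
  move=> t0; apply/is_derive_normP => e e0.
  have /continuous_normP/(_ e e0)[d d0 dP] := @segment_continuous R h n u cu t0.
  exists d => // t td; apply: hist_norm_le => [|th].
    by rewrite mulr_ge0// ltW.
  change (`|M t th - M t0 th - (t - t0) *: H2 t0 th| <= e * `|t - t0|).
  rewrite (ME t) (ME t0).
  rewrite (H2_transport t0 th).
  rewrite -/z0 -/(u _).
  (* the drift terms 2 b t theta q cancel exactly *)
  pose f v := U (v + \val th) - v *: u (t0 + \val th).
  have -> : (2 * b * t) *: (\val th *: q) + U (t + \val th) -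
      ((2 * b * t0) *: (\val th *: q) + U (t0 + \val th)) -
      (t - t0) *: ((2 * b * \val th) *: q + u (t0 + \val th)) = f t - f t0.
    have -> : (t - t0) *: ((2 * b * \val th) *: q + u (t0 + \val th)) =
        (2 * b * t) *: (\val th *: q) - (2 * b * t0) *: (\val th *: q) +
        (t *: u (t0 + \val th) - t0 *: u (t0 + \val th)).
      by rewrite scalerDr -!scalerBl !scalerA; congr (_ *: _ + _); ring.
    exact: zmod_cancel_drift.
  apply: (mean_value_col_sym (a := t0 - d) (b := t0 + d) (ltW e0)).
  - move=> v _; exact: is_deriveB (is_derive_shift (UP _)) (is_derive_scalel _ v).
  - move=> v; rewrite -ltr_distl => /dP; apply: le_trans.
    rewrite -(segmentE v th cu) -(segmentE t0 th cu).
    exact: (hist_norm_ub (segment h u v - segment h u t0)).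
  - by rewrite -ltr_distl subrr normr0.
  - by rewrite -ltr_distl.
exists (U T - U 0); apply/val_inj/funext => th.
change (M T th - M 0 th =
  (- (2 * b * T)) *: dhist id q th + (U T - U 0)).
rewrite (ME T) (ME 0) (dhistE (c := id)); last by move=> ?; exact: cvg_id.
rewrite mulr0 scale0r !add0r scaleNr scaleNr scalerN opprK -addrA.
congr (_ + _).
have dW (t : R) : is_derive t 1 (fun s => U (s + T) - U s) 0.
  have d1 : is_derive t 1 (fun s => U (s + T)) (u t).
    by have := is_derive_shift (UP (t + T)); rewrite /u H2_periodic.
  by have := is_deriveB d1 (UP t); rewrite subrr.
have cst s : U (s + T) - U s = U (0 + T) - U 0.
  apply/colP => i.
  apply: (@is_derive_0_is_cst R (fun s => (U (s + T) - U s) i 0)) => t.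
  have := (is_derive_colP _ t 0).1 (dW t) i.
  by rewrite mxE.
by rewrite [T + _]addrC cst add0r.
Qed.

End CenterManifoldFlow.

(** * The critical coefficient *)

Lemma integral_derivative (R : realType) (f F : R -> R) (a b : R) : a < b ->
  continuous f -> (forall t : R, is_derive t 1 F (f t)) ->
  (\int[lebesgue_measure]_(t in `[a, b]) f t)%R = F b - F a.
Proof.
move=> ab cf Ff.
have cF : continuous F by move=> t; exact: is_derive_continuous (Ff t).
rewrite /Rintegral (@continuous_FTC2 R f F a b ab) //.
- exact: continuous_subspaceT.
- split=> [t _||]; first by case: (Ff t).
  + exact/cvg_at_right_filter/cF.
  + exact/cvg_at_left_filter/cF.
- by move=> t _; rewrite derive1E; case: (Ff t).
Qed.

Definition rowdot (R : realType) (n : nat) (p : 'rV[R]_n) (v : 'cV[R]_n) : R :=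
  (p *m v) 0 0.

Lemma rowdotD (R : realType) (n : nat) (p : 'rV[R]_n) u v :
  rowdot p (u + v) = rowdot p u + rowdot p v.
Proof. by rewrite /rowdot mulmxDr mxE. Qed.

Lemma rowdotZ (R : realType) (n : nat) (p : 'rV[R]_n) a v :
  rowdot p (a *: v) = a * rowdot p v.
Proof. by rewrite /rowdot -scalemxAr mxE. Qed.

Lemma rowdotB (R : realType) (n : nat) (p : 'rV[R]_n) u v :
  rowdot p (u - v) = rowdot p u - rowdot p v.
Proof. by rewrite rowdotD -scaleN1r rowdotZ mulN1r. Qed.

Lemma rowdot_bound (R : realType) (n : nat) (p : 'rV[R]_n) v :
  `|rowdot p v| <= (\sum_j `|p 0 j|) * `|v|.
Proof.
rewrite /rowdot mxE mulr_suml (le_trans (ler_norm_sum _ _ _))//.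
by apply: ler_sum => j _; rewrite normrM ler_wpM2l// mx_norm_entry.
Qed.

Lemma rowdot_continuous (R : realType) (n : nat) (p : 'rV[R]_n) :
  continuous (rowdot p : 'cV[R]_n -> R^o).
Proof.
move=> v; apply/continuous_normP => e e0.
have K0 : 0 <= \sum_j `|p 0 j| by exact: sumr_ge0.
have K1 : 0 < \sum_j `|p 0 j| + 1 by rewrite ltr_wpDl.
exists (e / (\sum_j `|p 0 j| + 1)); first by rewrite divr_gt0.
move=> u /ltW uv; rewrite -rowdotB; apply: le_trans (rowdot_bound _ _) _.
apply: le_trans (ler_wpM2l K0 uv) _.
by rewrite mulrA ler_pdivrMr// mulrC ler_pM2l// lerDl.
Qed.

Lemma is_derive_rowdot (R : realType) (n : nat) (p : 'rV[R]_n)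
    (f : R -> 'cV[R]_n) (t : R) d :
  is_derive t 1 f d -> is_derive t 1 (fun s => rowdot p (f s)) (rowdot p d).
Proof.
apply: (@is_derive_lin _ _ R^o _ (\sum_j `|p 0 j|)).
- exact: sumr_ge0.
- exact: rowdotB.
- exact: rowdotZ.
- exact: rowdot_bound.
Qed.

Lemma equilibrium_zero (R : realType) (h : R) (n : nat)
    (F : R * hist h n -> 'cV[R]_n) (xbar : 'cV[R]_n) :
  equilibrium F xbar -> forall t, F (t, cst_hist h xbar) = 0.
Proof.
move=> eqF t; have t1 : t - 1 < t + 1 by lra.
have [_ /(_ t)] := eqF _ _ t1; have tt : t - 1 < t < t + 1 by apply/andP; split; lra.
move=> /(_ tt) [_ dF]; have cc : continuous (fun _ : R => xbar).
  by move=> ?; exact: cvg_cst.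
have sE : segment h (fun=> xbar) t = cst_hist h xbar.
  by apply/val_inj/funext => th; rewrite [LHS](segmentE t th cc).
by rewrite -sE -dF derive_cst.
Qed.

Theorem mainTheorem3 (R : realType) (n k : nat) (h T : R)
    (F : R * hist h n -> 'cV[R]_n) (xbar : 'cV[R]_n)
    (L : hist h n -> 'cV[R]_n) (zeta : R -> 'M[R]_n)
    (q : 'cV[R]_n) (p : 'rV[R]_n)
    (W : set (R * hist h n)) (delta : R)
    (H : R -> R -> hist h n) (H2 : R -> hist h n) (b : R)
    (h_gt0 : 0 < h) (T_gt0 : 0 < T) (k_ge2 : (2 <= k)%N)
    (F_smooth : Ck_on [set: R * hist h n] k F)
    (xbar_eq : equilibrium F xbar)
    (L_def : forall t, D2F F t (cst_hist h xbar) = L :> (_ -> _))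
    (G_periodic : forall t phi,
      nonlinear F xbar L (t + T) phi = nonlinear F xbar L t phi)
    (zeta_NBV : NBV h zeta) (zeta_L : represents zeta L)
    (simple0 : simple_eigenvalue L 0)
    (only0 : forall omega : R, eigenvalue_of L (0 +i* omega)%C -> omega = 0)
    (qP : charmx h zeta 0 *m map_mx (real_complex R) q = 0)
    (pP : map_mx (real_complex R) p *m charmx h zeta 0 = 0)
    (pqP : map_mx (real_complex R) p *m derive1 (charmx h zeta) 0
             *m map_mx (real_complex R) q = 1%:M)
    (W_lcm : local_center_manifold k T F xbar L W)
    (delta_gt0 : 0 < delta) (H_par : parametrizes xbar W delta H)
    (H2_periodic : forall t, H2 (t + T) = H2 t)
    (H_exp : expansion xbar (cst_hist h q) H2 H)
    (b_nf : normal_form F T delta H b) :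
  b = (2 * T)^-1 *
      \int[lebesgue_measure]_(t in `[0, T])
        (p *m D2F2 F t (cst_hist h xbar) (cst_hist h q) (cst_hist h q)) 0 0.
Proof.
have [dF ddF cddF] := Ck_on_C2 k_ge2 F_smooth.
have F0 := equilibrium_zero xbar_eq.
have [A LE] : exists A : blin (hist h n) 'cV[R]_n, L = A :> (_ -> _).
  by exists (D2F F 0 (cst_hist h xbar)); rewrite L_def.
subst L.
have LA t : restr (fderiv F (t, cst_hist h xbar)) = A.
  by rewrite -(D2FE dF); apply/val_inj; exact: L_def.
have Lq : A (cst_hist h q) = 0 by exact: right_null h_gt0 zeta_L _ qP.
have W_inv := lcm_invariant W_lcm.
pose B t : 'cV[R]_n := fderiv (fderiv F) (t, cst_hist h xbar)
  (0, cst_hist h q) (0, cst_hist h q).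
have [M dM [v MT]] := ex_mean_history h_gt0 dF ddF F0 W_inv delta_gt0 H_par H_exp
  b_nf H2_periodic.
pose z0 := clamp (ltW h_gt0) 0.
pose P t := (b * t) *: q + 2^-1 *: H2 t z0.
pose Y t := 2 *: P t - A (M t).
(* the terms L H2 of P and of M cancel in the derivative of Y *)
have dY (t : R) : is_derive t 1 Y (B t).
  have dP : is_derive t 1 P (2^-1 *: (A (H2 t) + B t)) :=
    H2_velocity h_gt0 dF ddF cddF F0 W_inv delta_gt0 H_par H_exp b_nf LA Lq t.
  have dAM : is_derive t 1 (fun s => A (M s)) (A (H2 t)).
    apply: (@is_derive_lin _ _ _ A `|A|) (dM t) => //.
    - exact: blinB.
    - exact: blinZ.
    - exact: blin_norm_ub.
  have := is_deriveB (is_deriveZ 2 dP) dAM.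
  by rewrite scalerA mulfV ?pnatr_eq0// scale1r [A _ + _]addrC addrK.
have cB : continuous B by exact: forcing_continuous cddF.
have cpB : continuous (fun t => rowdot p (B t)).
  move=> t; apply: (@continuous_comp _ _ _ B (rowdot p)); first exact: cB.
  exact: rowdot_continuous.
have -> : (\int[lebesgue_measure]_(t in `[0, T])
    (p *m D2F2 F t (cst_hist h xbar) (cst_hist h q) (cst_hist h q)) 0 0)%R =
    rowdot p (Y T) - rowdot p (Y 0).
  rewrite -(integral_derivative T_gt0 cpB (fun t => is_derive_rowdot p (dY t))).
  congr Rintegral; apply/funext => t.
  by rewrite (D2F2E dF ddF).
have HT : H2 T = H2 0 by rewrite -(H2_periodic 0) add0r.
have -> : rowdot p (Y T) - rowdot p (Y 0) = 2 * b * T.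
  rewrite -rowdotB /Y subrACA -scalerBr -blinB MT.
  have -> : P T - P 0 = (b * T) *: q.
    by rewrite /P HT mulr0 scale0r add0r addrK.
  rewrite blinD blinZ opprD scaleNr opprK addrA !(rowdotB, rowdotD) !rowdotZ.
  have pq := normalization h_gt0 zeta_L pqP.
  have {}pq : rowdot p q + rowdot p (A (dhist id q)) = 1.
    by rewrite -rowdotD /rowdot mulmxDr pq mxE eqxx.
  have pv : rowdot p (A (cst_hist h v)) = 0.
    by rewrite /rowdot (left_null h_gt0 zeta_L _ pP) mxE.
  rewrite pv subr0 -[RHS]mulr1 -pq; ring.
by field; rewrite gt_eqF.
Qed.
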